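(* Let $M=\{1^{k_1},2^{k_2},\ldots,n^{k_n}\}$ be a multiset with $n\ge 1$ and $k_1,k_2,\ldots,k_n$ positive integers. Let $K=k_1+k_2+\cdots+k_n$ and $M'=\{1^{K-n+1},2,\ldots,n\}$. Then there exists a bijection $\Psi:\overline{Q}_M\to\overline{Q}_{M'}$ such that for every $\pi\in\overline{Q}_M$, $$\mathrm{DR}(\pi)=\mathrm{DR}(\Psi(\pi))\quad\text{and}\quad (\underline{1},\underline{21},\ldots,\underline{n\cdots 21})\pi=(\underline{1},\underline{21},\ldots,\underline{n\cdots 21})\Psi(\pi).$$
   Context: $\{1^{k_1},\ldots,n^{k_n}\}$ denotes the multiset containing $k_\ell$ copies of the letter $\ell$ for each $\ell\in[n]=\{1,\ldots,n\}$; exponents equal to $1$ are omitted. A permutation (multipermutation) of $M$ is a word $\pi=\pi_1\pi_2\cdots\pi_K$ of length $K=|M|$ in which each letter $\ell$ occurs exactly $k_\ell$ times. It is a quasi-Stirling permutation if there do not exist indices $j_1<j_2<j_3<j_4$ with $\pi_{j_1}=\pi_{j_3}$, $\pi_{j_2}=\pi_{j_4}$ and $\pi_{j_1}\ne\pi_{j_2}$. $\overline{Q}_M$ is the set of quasi-Stirling permutations of $M$. The decreasing runs of $\pi$ are its maximal factors $\pi_j\pi_{j+1}\cdots\pi_{j'}$ (consecutive entries) with $\pi_j>\pi_{j+1}>\cdots>\pi_{j'}$. For a permutation $\pi$ of a multiset with letters in $[n]$, $\mathrm{DR}(\pi)=(m_1,\ldots,m_n)$, where $m_j$ is the number of decreasing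 runs of $\pi$ of length exactly $j$. For $s\ge1$, $(\underline{s\cdots 21})\pi$ is the number of occurrences of the consecutive pattern $\underline{s\cdots21}$ in $\pi$, i.e. the number of indices $j$ with $1\le j\le K-s+1$ and $\pi_j>\pi_{j+1}>\cdots>\pi_{j+s-1}$ (so $(\underline{1})\pi=K$). $(\underline{1},\underline{21},\ldots,\underline{n\cdots21})\pi$ is the tuple of these counts for $s=1,\ldots,n$. *)

(* Defs.v *)
From mathcomp Require Import all_boot.

Set Implicit Arguments.
Unset Strict Implicit.
Unset Printing Implicit Defensive.

(* Words are sequences over nat with letters 1, ..., n.  A multiset on [n] is
   given by its multiplicities k : 'I_n -> nat, the ordinal i standing for the
   letter i.+1. *)
Definition mset_word n (k : 'I_n -> nat) : seq nat :=
  flatten [seq nseq (k i) i.+1 | i <- enum 'I_n].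

Definition quasi_stirling (w : seq nat) : bool :=
  ~~ [exists j1 : 'I_(size w), exists j2 : 'I_(size w),
      exists j3 : 'I_(size w), exists j4 : 'I_(size w),
      [&& j1 < j2, j2 < j3, j3 < j4,
          nth 0 w j1 == nth 0 w j3,
          nth 0 w j2 == nth 0 w j4 &
          nth 0 w j1 != nth 0 w j2]].

Definition QS n (k : 'I_n -> nat) : Type :=
  {w : seq nat | perm_eq w (mset_word k) && quasi_stirling w}.

(* Positions are counted from 0; the interval [a, b[ denotes the nonempty
   factor w_a ... w_(b-1). *)
Definition dec_factor (w : seq nat) (a b : nat) : bool :=
  [&& a < b, b <= size w & sorted gtn (drop a (take b w))].

Definition dec_run (w : seq nat) (a b : 'I_(size w).+1) : bool :=
  dec_factor w a b &&
  [forall a' : 'I_(size w).+1, forall b' : 'I_(size w).+1,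
    [&& a' <= a, b <= b' & dec_factor w a' b'] ==> (a' == a) && (b' == b)].

Definition num_dec_runs (w : seq nat) (j : nat) : nat :=
  #|[set p : 'I_(size w).+1 * 'I_(size w).+1 |
      dec_run p.1 p.2 && (p.2 - p.1 == j)]|.

Definition DR n (w : seq nat) : n.-tuple nat :=
  [tuple num_dec_runs w j.+1 | j < n].

(* For s >= 1 an occurrence starts at a position j < size w, so ranging over
   'I_(size w) loses nothing. *)
Definition dec_pattern (s : nat) (w : seq nat) : nat :=
  #|[set j : 'I_(size w) | dec_factor w j (j + s)]|.

Definition dec_patterns n (w : seq nat) : n.-tuple nat :=
  [tuple dec_pattern s.+1 w | s < n].

(* Multiplicities of {1^(K-n+1), 2, ..., n}.  The subtraction does not truncate
   when all the k i are positive. *)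
Definition mult1 n (k : 'I_n -> nat) (i : 'I_n) : nat :=
  if i == 0 :> nat then \sum_(l < n) k l - n + 1 else 1.

(* Main.v *)
Require Import Defs.
From mathcomp Require Import all_boot zify.

Set Implicit Arguments.
Unset Strict Implicit.
Unset Printing Implicit Defensive.

(** Decreasing runs are strictly decreasing, and both [DR] and [dec_patterns]
    only depend on the multiset of the lengths of the maximal runs
    ([DR_runs]): a run of length r contains r - s + 1 occurrences of the pattern
    of length s <= r.  It is thus enough to show that the multiset of run
    lengths has the same distribution on both sides; equidistribution on two
    finite sets gives the bijection ([perm_map_bij]).  What holds more generally
    is that this distribution depends only on the number n of letters and on the
    total multiplicity K ([run_types_mword]).

    The proof is by induction on n.  Let N < n be the two largest letters, with
    multiplicities a and k.  All copies of n but one are first traded for copies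
    of N, without changing the distribution ([shift_run_types]).  After that, n
    occurs once, so a word is a quasi-Stirling word on the smaller letters
    together with a position for n.  Inserting n into a run of length r yields
    run lengths that depend on r and on the position inside the run only, so the
    distribution is determined by the one for n - 1 letters
    ([run_types_insert_perm]).

    The trade is a bijection, the relation [shift].  A letter n or N followed by
    smaller letters forms a block; since n and N exceed everything else, a block
    x g starts a new run, whose shape does not depend on whether x is n or N.
    The only exception is a letter n immediately followed by N.  So, away from
    this exception, blocks may be renamed and permuted freely without changing
    the multiset of run lengths ([shift_runs]).

    The quasi-Stirling condition constrains the contents of blocks: what stands
    between two consecutive copies of x has no letter in common with the rest of
    the word, and apart from that is an arbitrary quasi-Stirling word
    ([qs_pinch]).  Hence a block n g followed by another n can be detached and
    put, as N g, in front of any N.  The word seen cyclically has one arc of n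
    and one arc of N, and the two gaps between these arcs may share letters.  The
    trade has to keep such a pair of gaps together, and its four cases correspond
    to the position of the arcs with respect to the ends of the word.  If the
    letter n that precedes N is adjacent to it, then the gap between them is
    empty, nothing is shared, and the blocks stay where they are, which protects
    the exceptional adjacency.  The image word determines the case through the
    number of N before its single n, compared with k, and through whether n is
    adjacent to a following N; this is how [shift_bwd] inverts the trade. *)

(** * Decreasing runs determine the statistics *)

Fixpoint runs (w : seq nat) : seq nat :=
  if w is x :: v then
    if head x v < x then (head 0 (runs v)).+1 :: behead (runs v) else 1 :: runs v
  else [::].

Lemma runs_cat u v :
  last 0 u <= head (last 0 u) v -> runs (u ++ v) = runs u ++ runs v.
Proof.
elim: u => //= x [|y u] IH /=.
  by move=> xy; rewrite ltnn ltnNge xy.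
move=> /IH /= ->; case: (y < x) => //.
by case: (head y u < y).
Qed.

Lemma runs_decreasing (r : seq nat) : r != [::] -> sorted gtn r -> runs r = [:: size r].
Proof.
elim: r => // x [|y r] IH _ /=; first by rewrite ltnn.
by case/andP=> yx pr; have /= -> := IH isT pr; rewrite yx.
Qed.

(** The head of a run does not matter as soon as it exceeds what follows: this
    is why a block may change its leading letter. *)
Lemma runs_max x y g : all (ltn^~ x) g -> all (ltn^~ y) g ->
  runs (x :: g) = runs (y :: g).
Proof. by case: g => [|z g] /=; rewrite ?ltnn // => /andP[-> _] /andP[-> _]. Qed.

Lemma first_run x w : exists r w' : seq nat, [/\ x :: w = r ++ w', r != [::],
  sorted gtn r & last 0 r <= head (last 0 r) w'].
Proof.
elim: w x => [|y w IH] x; first by exists [:: x], [::].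
have [yx|xy] := ltnP y x; last by exists [:: x], (y :: w).
have [[|z r] [w' [// E _ S L]]] := IH y; case: E => Ey Ew; subst z.
by exists [:: x, y & r], w'; rewrite Ew /= yx; split.
Qed.

(** Peeling off the first maximal run: statistics of positions are computed
    along this decomposition. *)
Lemma runs_ind (P : seq nat -> Prop) :
  P [::] ->
  (forall r w : seq nat, r != [::] -> sorted gtn r -> last 0 r <= head (last 0 r) w ->
     P w -> P (r ++ w)) ->
  forall w, P w.
Proof.
move=> P0 PS w; have [m] := ubnP (size w); elim: m w => // m IH [|x w] // sz.
have [r [w' [E r0 S L]]] := first_run x w; rewrite E; apply: PS => //; apply: IH.
by move: (congr1 size E) r0 sz => /=; rewrite size_cat; case: r {E S L} => //= *; lia.
Qed.

Lemma dec_factor_sub w a b a' b' :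
  a' <= a -> a < b -> b <= b' -> dec_factor w a' b' -> dec_factor w a b.
Proof.
move=> a'a ab bb' /and3P[_ b'w S]; apply/and3P; split; [by []|lia|].
have -> : drop a (take b w) = drop (a - a') (take (b - a') (drop a' (take b' w))).
  rewrite take_drop subnK; last lia.
  by rewrite drop_drop subnK // take_takel.
by apply/drop_sorted/take_sorted.
Qed.

(** When r is a maximal run at the front, no decreasing factor crosses its
    right end. *)
Lemma dec_factor_cat (r w : seq nat) a b :
    r != [::] -> sorted gtn r -> last 0 r <= head (last 0 r) w ->
  dec_factor (r ++ w) a b =
    if b <= size r then a < b
    else (size r <= a) && dec_factor w (a - size r) (b - size r).
Proof.
move=> r0 S L; case: ifP => br.
  rewrite /dec_factor; case: ltnP => //= ab.
  rewrite takel_cat // size_cat (leq_trans br (leq_addr _ _)) /=.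
  exact/drop_sorted/take_sorted.
have Eb : (b < size r) = false by lia.
rewrite /dec_factor size_cat; have [ra|ar] := leqP (size r) a.
  rewrite take_cat Eb drop_cat (ltnNge a (size r)) ra /=; congr [&& _, _ & _]; lia.
apply/negP=> /and3P[_ bw]; rewrite take_cat Eb /= drop_cat ar.
have: 0 < size (drop a r) by rewrite size_drop subn_gt0.
have: last 0 (drop a r) = last 0 r by rewrite -{2}(cat_take_drop a r) last_cat; case: (drop a r) (size_drop a r) => //=; lia.
have: 0 < b - size r by lia.
case: (drop a r) => // x s b0 El _.
case: w L bw => [|y w] /= L bw; first by rewrite addn0 in bw; lia.
case: (b - size r) b0 => // m _ /=; rewrite cat_path /= => /and3P[_ H _].
by move: El H L => /= -> H; rewrite leqNgt H.
Qed.

(** Maximality of a decreasing factor only needs to be tested against extensions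
    by one letter, on the left and on the right. *)
Definition run_at w a b := [&& dec_factor w a b,
   ~~ ((0 < a) && dec_factor w a.-1 b) & ~~ dec_factor w a b.+1].

Lemma dec_runE w (a b : 'I_(size w).+1) : dec_run a b = run_at w a b.
Proof.
rewrite /dec_run /run_at; case D: (dec_factor w a b) => //=.
have [ab bw] : a < b /\ b <= size w by case/and3P: D.
apply/forallP/andP.
  move=> H; split; apply/negP.
    case/andP=> a0 D'; have Ha : a.-1 < (size w).+1 by lia.
    move/forallP/(_ b): (H (Ordinal Ha)) => /=; rewrite leq_pred leqnn D' /=.
    by rewrite -val_eqE /=; lia.
  move=> D'; have Hb : b.+1 < (size w).+1 by case/and3P: D'.
  move/forallP/(_ (Ordinal Hb)): (H a) => /=; rewrite leqnn leqnSn D' /=.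
  by rewrite andbC -val_eqE /=; lia.
move=> [Na Nb] a'; apply/forallP=> b'; apply/implyP=> /and3P[a'a bb' D'].
rewrite -!val_eqE /=; apply/andP; split.
  rewrite eqn_leq a'a leqNgt; apply: contra Na => lt.
  by rewrite (leq_ltn_trans (leq0n _) lt) (dec_factor_sub _ _ bb' D') //; lia.
rewrite eqn_leq bb' andbT leqNgt; apply: contra Nb => lt.
by rewrite (dec_factor_sub a'a _ lt D') //; lia.
Qed.

Lemma card_ord_count m (P : pred nat) : #|[set i : 'I_m | P i]| = count P (iota 0 m).
Proof.
by rewrite cardsE cardE /enum_mem size_filter -enumT -val_enum_ord count_map; apply: eq_count => i.
Qed.

(** If a property of positions restricts to every run separately, its count is
    a sum over the run lengths. *)
Lemma count_iota_runs (g : nat -> nat) w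
    (P : seq nat -> pred nat) :
  (forall r v : seq nat, r != [::] -> sorted gtn r -> last 0 r <= head (last 0 r) v ->
     count (P (r ++ v)) (iota 0 (size r)) = g (size r) /\
     forall a, P (r ++ v) (size r + a) = P v a) ->
  count (P w) (iota 0 (size w)) = sumn (map g (runs w)).
Proof.
move=> H; elim/runs_ind: w => // r w r0 S L IH.
have [H1 H2] := H r w r0 S L.
rewrite runs_cat // runs_decreasing //= size_cat iotaD count_cat H1 -IH add0n.
congr (_ + _); rewrite -[size r]addn0 iotaDl count_map.
by apply: eq_count => a /=; rewrite H2.
Qed.

Lemma num_dec_runsE w j : num_dec_runs w j.+1 = count_mem j.+1 (runs w).
Proof.
have -> : num_dec_runs w j.+1 = count (fun a => run_at w a (a + j.+1)) (iota 0 (size w)).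
  rewrite -card_ord_count /num_dec_runs.
  pose f (a : 'I_(size w)) : 'I_(size w).+1 * 'I_(size w).+1 :=
    (widen_ord (leqnSn _) a, inord (a + j.+1)).
  have f_inj : injective f by move=> a b [/val_inj].
  rewrite -(card_imset _ f_inj); apply: eq_card => -[a b]; rewrite !inE /=.
  rewrite dec_runE; apply/idP/imsetP.
    case/andP=> R /eqP E; have [ab bw] : a < b /\ b <= size w by case/and3P: R => /and3P[].
    have aw : a < size w by lia.
    exists (Ordinal aw); first by rewrite inE /= -E subnKC // ltnW.
    congr (_, _); first exact: val_inj.
    by apply: val_inj; rewrite /= inordK -?E ?subnKC // ltnW.
  case=> c; rewrite inE => R [-> ->].
  have H : c + j.+1 <= size w by case/and3P: R => /and3P[].
  by rewrite /= inordK // R addKn eqxx.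
rewrite (@count_iota_runs (fun r => r == j.+1)
  w (fun w a => run_at w a (a + j.+1))).
  by elim: (runs w) => //= r s ->.
move=> r v r0 S L; split; last first.
  move=> a; rewrite /run_at !dec_factor_cat //.
  have -> : size r + a + j.+1 <= size r = false by lia.
  have -> : size r + a + j.+1 < size r = false by lia.
  have -> : size r + a - size r = a by lia.
  have -> : size r + a + j.+1 - size r = a + j.+1 by lia.
  have -> : (size r + a + j.+1).+1 - size r = (a + j.+1).+1 by lia.
  have r_gt0 : 0 < size r by case: (r) r0.
  rewrite leq_addr /=; case: a => [|a].
    have -> // : size r <= (size r + 0).-1 = false by lia.
    by rewrite andbF.
  have -> : (size r + a.+1).-1 = size r + a by lia.
  by rewrite leq_addr addKn addn_gt0 r_gt0.
have r_gt0 : 0 < size r by case: (r) r0.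
have -> : iota 0 (size r) = 0 :: iota 1 (size r).-1 by rewrite -{1}(prednK r_gt0).
have count_cons p (s : seq nat) : count p (0 :: s) = p 0 + count p s by [].
rewrite count_cons (eq_in_count (a2 := pred0)) => [|a]; last first.
  rewrite mem_iota => /andP[a0 ar]; rewrite /run_at !dec_factor_cat //.
  have -> : a.-1 < a + j.+1 by move: a a0 {ar} => a; lia.
  have -> : size r <= a = false by move: a a0 ar => a; lia.
  by rewrite a0; case: ifP; rewrite ?andbF.
rewrite count_pred0 addn0; congr nat_of_bool; rewrite /run_at !dec_factor_cat //.
have -> : size r <= 0 = false by lia.
by rewrite add0n ltnS leq0n eqn_leq; case: (ltngtP (size r) j.+1).
Qed.

Lemma dec_patternE w s : dec_pattern s.+1 w = sumn [seq r - s | r <- runs w].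
Proof.
rewrite /dec_pattern (card_ord_count _ (fun j => dec_factor w j (j + s.+1))).
rewrite (@count_iota_runs (fun r => r - s)
  w (fun w j => dec_factor w j (j + s.+1))) // => r v r0 S L; split; last first.
  move=> a; rewrite dec_factor_cat // -addnA leqNgt -[X in X < _]addn0 ltn_add2l.
  by rewrite addnS /= leq_addr !addKn.
rewrite (eq_in_count (a2 := fun a => a < size r - s)); last first.
  move=> a; rewrite mem_iota => /andP[_ ar]; rewrite dec_factor_cat //.
  case: ifP; lia.
have Er : size r = (size r - s) + (size r - (size r - s)) by lia.
rewrite [X in iota 0 X]Er iotaD count_cat (eq_in_count (a2 := predT)).
  rewrite count_predT size_iota (eq_in_count (a2 := pred0)) ?count_pred0 ?addn0 // => a.
  by rewrite mem_iota /=; lia.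
by move=> a; rewrite mem_iota /=; lia.
Qed.

Lemma DR_runs n w w' : perm_eq (runs w) (runs w') ->
  DR n w = DR n w' /\ dec_patterns n w = dec_patterns n w'.
Proof.
move=> pw; split; apply: eq_from_tnth => i; rewrite !tnth_mktuple.
  by rewrite !num_dec_runsE; apply/permP.
by rewrite !dec_patternE; apply/perm_sumn/perm_map.
Qed.

(** * Subword form of the quasi-Stirling condition *)

Lemma subseq_catP (T : eqType) (s u v : seq T) :
  reflect (exists s1 s2, [/\ s = s1 ++ s2, subseq s1 u & subseq s2 v])
          (subseq s (u ++ v)).
Proof.
apply: (iffP idP) => [|[s1 [s2 [-> ? ?]]]]; last exact: cat_subseq.
elim: u s => [|x u IH] s /=; first by exists [::], s.
case: s => [|y s]; first by exists [::], [::]; rewrite sub0seq.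
case: eqP => [->|ne] /IH [s1 [s2 [E U V]]].
  by exists (x :: s1), s2; rewrite E /= eqxx.
exists s1, s2; split => //; case: s1 {E} U => //= z s1.
by case: ifP => // _ /(subseq_trans (subseq_cons s1 z)).
Qed.

(** Four positions of a crossing are a subword abab, and conversely. *)
Lemma qsP (w : seq nat) : reflect (forall a b : nat, a != b -> ~~ subseq [:: a; b; a; b] w)
                      (quasi_stirling w).
Proof.
pose f := nth 0 w.
have Ew : map f (iota 0 (size w)) = w by rewrite map_nth_iota0 // take_size.
have ltn_tr := ltn_trans; rewrite /quasi_stirling.
apply: (iffP idP) => [H a b ab | H].
  apply: contra H; rewrite -{1}Ew => /subseqP[m sz]; rewrite -map_mask.
  case E: (mask m _) => [|j1 [|j2 [|j3 [|j4 [|? ?]]]]] //= [E1 E2 E3 E4].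
  have S : subseq [:: j1; j2; j3; j4] (iota 0 (size w)) by rewrite -E mask_subseq.
  have := mem_subseq S; have /= := subseq_sorted ltn_tr S (iota_ltn_sorted _ _).
  case/and4P=> l1 l2 l3 _ M.
  have lt j : j \in [:: j1; j2; j3; j4] -> j < size w by move/M; rewrite mem_iota.
  have h1 : j1 < size w by apply: lt; rewrite !inE eqxx.
  have h2 : j2 < size w by apply: lt; rewrite !inE eqxx ?orbT.
  have h3 : j3 < size w by apply: lt; rewrite !inE eqxx ?orbT.
  have h4 : j4 < size w by apply: lt; rewrite !inE eqxx ?orbT.
  apply/existsP; exists (Ordinal h1); apply/existsP; exists (Ordinal h2).
  apply/existsP; exists (Ordinal h3); apply/existsP; exists (Ordinal h4).
  rewrite /= l1 l2 l3 -[nth 0 w j1]/(f j1) -[nth 0 w j2]/(f j2).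
  by rewrite -[nth 0 w j3]/(f j3) -[nth 0 w j4]/(f j4) -E1 -E2 -E3 -E4 !eqxx.
apply/negP=> /existsP[j1 /existsP[j2 /existsP[j3 /existsP[j4]]]].
case/and5P=> l1 l2 l3 /eqP E1 /andP[/eqP E2 ne]; have := H _ _ ne.
have -> : [:: nth 0 w j1; nth 0 w j2; nth 0 w j1; nth 0 w j2] = 
  map f [:: val j1; val j2; val j3; val j4] by rewrite /= /f -E1 -E2.
move/negP; apply; set js := [:: _; _; _; _].
suff S : subseq js (iota 0 (size w)) by have := map_subseq f S; rewrite Ew.
have -> : js = [seq j <- iota 0 (size w) | j \in js]; last exact: filter_subseq.
apply: (irr_sorted_eq ltn_tr ltnn); rewrite /= ?l1 ?l2 ?l3 //.
  by apply: sorted_filter; [exact: ltn_tr | exact: iota_ltn_sorted].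
move=> j; rewrite mem_filter mem_iota /=; case J: (j \in js) => //=.
by move: J; rewrite !inE => /or4P[] /eqP->; rewrite ltn_ord.
Qed.

Lemma qsPn (w : seq nat) (a b : nat) : quasi_stirling w -> a != b -> ~~ subseq [:: a; b; a; b] w.
Proof. by move/qsP; apply. Qed.

Lemma qs_subseq u w : subseq u w -> quasi_stirling w -> quasi_stirling u.
Proof.
move=> uw /qsP H; apply/qsP=> a b /H; apply: contra => S; exact: subseq_trans uw.
Qed.

Lemma qs_rot1 (x : nat) (w : seq nat) : quasi_stirling (x :: w) -> quasi_stirling (rcons w x).
Proof.
move=> /qsP H; apply/qsP=> a b ab; apply/negP; rewrite -cats1.
case/subseq_catP=> s1 [s2 [E S1 S2]].
case: s2 E S2 => [|y [|z s2]]; rewrite ?cats0.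
- move=> Es; rewrite -Es in S1; case/negP: (H _ _ ab).
  exact: subseq_trans (subseq_cons w x).
- rewrite cats1 => Er; have [Es Ey] : [:: a; b; a] = s1 /\ b = y.
    by case: (rcons_inj (Er : rcons [:: a; b; a] b = rcons s1 y)).
  rewrite sub1seq inE => /eqP Ex.
  rewrite eq_sym in ab; case/negP: (H _ _ ab).
  by rewrite -Ex -Ey /= eqxx -/(subseq [:: a; b; a] w) Es.
by move=> _ /size_subseq.
Qed.

(** Noncrossing is a property of the circular word: a crossing abab turns into
    the crossing baba when its last letter moves to the front. *)
Lemma qs_rot u v : quasi_stirling (u ++ v) = quasi_stirling (v ++ u).
Proof.
have H : forall u v, quasi_stirling (u ++ v) -> quasi_stirling (v ++ u).
  elim=> [|x {}u IH] {}v; first by rewrite cats0.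
  by rewrite cat_cons => /qs_rot1; rewrite rcons_cat => /IH; rewrite cat_rcons.
by apply/idP/idP; apply: H.
Qed.

Lemma qs_map f w : involutive f -> quasi_stirling (map f w) = quasi_stirling w.
Proof.
move=> fK; have H : forall w, quasi_stirling w -> quasi_stirling (map f w).
  move=> {}w /qsP Q; apply/qsP=> a b ab; apply/negP=> /(map_subseq f).
  by rewrite (mapK fK); apply/negP; apply: Q; rewrite (inv_eq fK) fK.
by apply/idP/idP => [/H|/H//]; rewrite (mapK fK).
Qed.

Definition disj (s t : seq nat) := ~~ has (mem t) s.

Lemma disjP s t : reflect (forall c, c \in s -> c \notin t) (disj s t).
Proof. exact: hasPn. Qed.

Lemma subseq_dropl c (s u v : seq nat) : c \notin u ->
  subseq (c :: s) (u ++ v) -> subseq (c :: s) v.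
Proof.
by elim: u => //= x u IH; rewrite inE negb_or; case: eqP.
Qed.

Lemma subseq_dropr c (s u v : seq nat) : c \notin v ->
  subseq (rcons s c) (u ++ v) -> subseq (rcons s c) u.
Proof.
rewrite -mem_rev -subseq_rev rev_rcons rev_cat => cv /(subseq_dropl cv).
by rewrite -rev_rcons subseq_rev.
Qed.

Lemma subseq_sandwich (c d : nat) u m v : c \notin u -> c \notin v ->
  subseq [:: c; d; c] (u ++ m ++ v) -> subseq [:: c; d; c] m.
Proof. by move=> cu cv /(subseq_dropl cu)/(@subseq_dropr c [:: c; d] m v cv). Qed.

(** An alternating word cannot use two adjacent equal letters. *)
Lemma subseq_dup (x : nat) s u v : sorted (fun a b => a != b) s ->
  subseq s (u ++ x :: x :: v) -> subseq s (u ++ x :: v).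
Proof.
elim: u s => [|y u IH] [|z s] S; rewrite ?sub0seq //=; last first.
  by case: eqP => _; apply: IH => //; exact: path_sorted S.
have [Ez|/negPf->//] := eqVneq z x; case: s S => [|t s] /=; first by rewrite sub0seq.
by rewrite -Ez eq_sym => /andP[/negPf-> _].
Qed.

(** The word m is empty or starts with x, so m ++ [:: x] is an excursion from x
    to x.  A letter other than x occurring both inside and outside the excursion
    crosses x; conversely, if no letter is shared, the two outer letters of
    a crossing cdc confine it to m, or m only contributes copies of x next to
    another x, which create no crossing. *)
Lemma qs_pinch (x : nat) u m v : head x m = x ->
  quasi_stirling (u ++ m ++ x :: v) =
  [&& quasi_stirling (u ++ x :: v), quasi_stirling m &
      disj [seq c <- m | c != x] (u ++ v)].
Proof.
move=> hm; apply/idP/and3P => [Q|[Q1 Q2 /disjP D]].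
  split.
  - apply: qs_subseq Q; apply: cat_subseq => //; exact: suffix_subseq.
  - apply: qs_subseq Q; apply: subseq_trans (suffix_subseq _ _).
    exact: prefix_subseq.
  apply/disjP=> c; rewrite mem_filter => /andP[cx cm].
  case: m hm cm Q => //= y m ->; rewrite inE (negPf cx) /= => cm Q.
  rewrite mem_cat negb_or; apply/andP; split; apply/negP=> cuv.
    case/negP: (qsPn Q cx); rewrite -cat1s; apply: cat_subseq; rewrite ?sub1seq //.
    rewrite /= eqxx -[[:: c; x]]/([:: c] ++ [:: x]).
    by apply: cat_subseq; rewrite ?sub1seq ?inE ?eqxx.
  rewrite eq_sym in cx; case/negP: (qsPn Q cx); apply: subseq_trans (suffix_subseq _ _).
  rewrite /= eqxx -[[:: c; x; c]]/([:: c] ++ [:: x; c]).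
  by apply: cat_subseq; rewrite ?sub1seq //= eqxx sub1seq.
apply/qsP=> a b ab; apply/negP=> S.
have sep c : c \in m -> c != x -> c \notin u /\ c \notin x :: v.
  move=> cm cx; have := D c; rewrite mem_filter cx cm => /(_ isT).
  by rewrite mem_cat negb_or inE negb_or cx => /andP[].
have key c d : c \in m -> c != x -> d != c ->
    subseq [:: c; d; c] (u ++ m ++ x :: v) -> d \in m /\ d != x.
  move=> cm cx dc S1; have [cu cv] := sep c cm cx.
  have S2 := subseq_sandwich cu cv S1.
  split; first by apply: (mem_subseq S2); rewrite !inE eqxx orbT.
  apply: contraTneq Q2 => dx; apply/negP=> Q2; case/negP: (qsPn Q2 dc).
  case: m hm S2 {Q2 D sep cm S S1} => //= y m ->.
  by rewrite (negPf cx) dx eqxx.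
have ba : b != a by rewrite eq_sym.
have S1 := subseq_trans (prefix_subseq [:: a; b; a] [:: b]) S.
have S2 := subseq_trans (suffix_subseq [:: a] [:: b; a; b]) S.
(* If a occurs in m, then so does b by [key], hence neither occurs outside m
   and the whole crossing lies in m. *)
have inm : a \in m -> a != x -> False.
  move=> am ax; have [bm bx] := key a b am ax ba S1.
  have [au _] := sep a am ax; have [_ bv] := sep b bm bx.
  case/negP: (qsPn Q2 ab).
  exact: (@subseq_dropr b [:: a; b; a] m _ bv (subseq_dropl au S)).
have inmb : b \in m -> b != x -> False.
  by move=> bm bx; have [am ax] := key b a bm bx ab S2; apply: inm.
(* Now m contributes only copies of x to the letters a and b, and these are
   absorbed by the x that follows m. *)
pose p := pred2 a b.
have Sf : subseq [:: a; b; a; b] (filter p u ++ filter p m ++ x :: filter p v).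
  apply: (@subseq_trans _ (filter p (u ++ m ++ x :: v))).
    by rewrite subseq_filter S /p /= !eqxx ?orbT.
  rewrite !filter_cat; apply: cat_subseq => //; apply: cat_subseq => //.
  by case E: (p x); rewrite -[filter p (x :: v)]/(if p x then x :: filter p v
    else filter p v) E ?subseq_refl ?subseq_cons.
have {}Sf : subseq [:: a; b; a; b] (filter p u ++ x :: filter p v).
  have : all (pred1 x) (filter p m).
    apply/allP=> c; rewrite mem_filter => /andP[/pred2P[]-> cm]; apply/eqP.
      by apply/eqP; case: eqP => // /eqP/(inm cm).
    by apply/eqP; case: eqP => // /eqP/(inmb cm).
  elim: (filter p m) Sf => //= y t IH Sf /andP[/eqP Ey /[dup] /all_pred1P Et].
  apply: IH; rewrite {}Et {}Ey in Sf *; move: Sf.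
  have alt : sorted (fun a b => a != b) [:: a; b; a; b] by rewrite /= ab eq_sym ab.
  case: (size t) => [|k]; exact: (subseq_dup alt).
case/negP: (qsPn Q1 ab); apply: subseq_trans Sf _.
by apply: cat_subseq; rewrite ?filter_subseq //= eqxx filter_subseq.
Qed.

(** * Quasi-Stirling words cut into blocks *)

Fixpoint blocks (x : nat) (gs : seq (seq nat)) : seq nat :=
  if gs is g :: gs' then x :: g ++ blocks x gs' else [::].

Lemma blocks_cat x gs hs : blocks x (gs ++ hs) = blocks x gs ++ blocks x hs.
Proof. by elim: gs => //= g gs ->; rewrite catA. Qed.

Lemma blocks_cons x g gs : blocks x (g :: gs) = x :: g ++ blocks x gs.
Proof. by []. Qed.

Lemma blocks_rcons x gs g : blocks x (rcons gs g) = blocks x gs ++ x :: g.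
Proof. by rewrite -cats1 blocks_cat /= cats0. Qed.

Lemma count_blocks p x gs :
  count p (blocks x gs) = size gs * p x + count p (flatten gs).
Proof. by elim: gs => //= g gs IH; rewrite !count_cat IH; lia. Qed.

Lemma mem_blocks c x gs :
  (c \in blocks x gs) = (0 < size gs) && (c == x) || (c \in flatten gs).
Proof.
elim: gs => //= g gs IH; rewrite inE mem_cat IH mem_cat.
by case: (c == x) (c \in g) (c \in flatten gs) => [] [] []; rewrite ?andbF.
Qed.

Lemma disj_catl s1 s2 t : disj (s1 ++ s2) t = disj s1 t && disj s2 t.
Proof. by rewrite /disj has_cat negb_or. Qed.

Lemma disj_sym s t : disj s t = disj t s.
Proof. by rewrite /disj has_sym. Qed.

Lemma disj_catr s t1 t2 : disj s (t1 ++ t2) = disj s t1 && disj s t2.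
Proof. by rewrite disj_sym disj_catl !(disj_sym s). Qed.

Lemma disj_consl x s t : x \notin t -> disj (x :: s) t = disj s t.
Proof. by move=> xt; rewrite /disj /= negb_or xt. Qed.

Lemma disj_consr x s t : x \notin s -> disj s (x :: t) = disj s t.
Proof. by move=> xs; rewrite disj_sym disj_consl // disj_sym. Qed.

Lemma disj_blocksl x gs t : x \notin t -> disj (blocks x gs) t = disj (flatten gs) t.
Proof.
move=> xt; elim: gs => //= g gs IH.
by rewrite disj_consl // !disj_catl IH.
Qed.

Lemma disj_blocksr s x gs : x \notin s -> disj s (blocks x gs) = disj s (flatten gs).
Proof. by move=> xs; rewrite disj_sym disj_blocksl // disj_sym. Qed.

(** A letter that occurs once cannot take part in a crossing. *)
Lemma qs_fresh x u v : x \notin u -> x \notin v ->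
  quasi_stirling (u ++ x :: v) = quasi_stirling (u ++ v).
Proof.
move=> xu xv; apply/idP/idP; first by apply: qs_subseq; rewrite subseq_cat2l subseq_cons.
move=> Q; apply/qsP=> a b ab; apply/negP=> S.
have cW : count_mem x (u ++ x :: v) = 1.
  by rewrite count_cat /= eqxx !(count_memPn _).
have := leq_count_subseq (pred1 x) S; rewrite cW /=.
have [ax|ax] := eqVneq a x; first by case: (b == x).
have [bx|bx _] := eqVneq b x; first by [].
have : subseq [:: a; b; a; b] [seq c <- u ++ x :: v | c != x].
  by rewrite subseq_filter S /= ax bx.
rewrite filter_cat /= eqxx -filter_cat (all_filterP _) => [|].
  by apply/negP/qsPn.
by apply/allP=> c; rewrite mem_cat => H; apply: contraTneq H => ->; rewrite negb_or xu.
Qed.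

Lemma qs_pinch_blocks x gs u v : x \notin flatten gs ->
  quasi_stirling (u ++ blocks x gs ++ x :: v) =
  [&& quasi_stirling (u ++ x :: v), quasi_stirling (blocks x gs) &
      disj (flatten gs) (u ++ v)].
Proof.
move=> xgs; rewrite qs_pinch; last by case: gs {xgs}.
congr [&& _, _ & _]; congr disj; elim: gs xgs => //= g gs IH.
rewrite mem_cat negb_or => /andP[xg xgs].
rewrite eqxx filter_cat IH //; congr (_ ++ _).
by apply/all_filterP/allP=> c; apply: contraTneq => ->.
Qed.

Lemma qs_piece x g u v : x \notin g ->
  quasi_stirling (u ++ x :: g ++ x :: v) =
  [&& quasi_stirling (u ++ x :: v), quasi_stirling g & disj g (u ++ v)].
Proof.
move=> xg; have := @qs_pinch_blocks x [:: g] u v; rewrite /= cats0.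
by move=> ->//; rewrite (@qs_fresh x [::] g).
Qed.

(** Exchanging x and y is a bijection of the alphabet, which preserves
    crossings. *)
Lemma qs_blocks_rename x y gs : x \notin flatten gs -> y \notin flatten gs ->
  quasi_stirling (blocks x gs) = quasi_stirling (blocks y gs).
Proof.
move=> xgs ygs; pose f c := if c == x then y else if c == y then x else c.
have fK : involutive f.
  move=> c; rewrite /f; have [->|cx] := eqVneq c x.
    by rewrite eqxx; case: eqP.
  have [->|cy] := eqVneq c y; first by rewrite eqxx.
  by rewrite (negPf cx) (negPf cy).
rewrite -(qs_map _ fK); congr quasi_stirling.
elim: gs xgs ygs => //= g gs IH; rewrite !mem_cat !negb_or.
move=> /andP[xg xgs] /andP[yg ygs]; rewrite map_cat IH // {1}/f eqxx.
congr (_ :: _ ++ _); apply: map_id_in => c cg; rewrite /f.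
by rewrite !ifN //; apply: contraTneq cg => ->.
Qed.

Section TwoLetters.
Variables (N n : nat) (nN : n != N).

Definition avoids (s : seq nat) := (N \notin s) && (n \notin s).

(** The next four lemmas compare the words on the two sides of the four cases of
    [shift].  In each of them, pinching out the blocks reduces both words to the
    same core, with the same requirement that the detached pieces share no
    letters with each other or with the core. *)
Lemma qs_shift_before l e gs rest : avoids (flatten gs) ->
  quasi_stirling (l ++ N :: e ++ blocks n gs ++ n :: rest) =
  quasi_stirling (l ++ blocks N gs ++ N :: e ++ n :: rest).
Proof.
case/andP=> Ng ng.
rewrite -[l ++ N :: _ ++ blocks n gs ++ _]/(l ++ (N :: e) ++ _) catA.
rewrite !qs_pinch_blocks // (@qs_blocks_rename N n) // -catA.
by rewrite !(disj_catr, disj_consr _ (x := N), disj_consr _ (x := n)) // -?andbA.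
Qed.

Lemma qs_shift_after al gs be fs : avoids al -> avoids (flatten gs) ->
    avoids (flatten fs) -> fs != [::] -> avoids be ->
  quasi_stirling (al ++ blocks n gs ++ n :: be ++ blocks N fs) =
  quasi_stirling (al ++ n :: be ++ blocks N gs ++ blocks N fs).
Proof.
case: fs => // f fs /andP[Nal nal] /andP[Ng ng] /andP[].
rewrite /= !mem_cat !negb_or => /andP[Nf Nfs] /andP[nf nfs] _ /andP[Nbe nbe].
rewrite -[al ++ n :: be ++ _]/(al ++ (n :: be) ++ _) (catA al (n :: be)).
rewrite !qs_pinch_blocks // (@qs_blocks_rename N n) // -catA.
rewrite !(disj_catr, disj_consr _ (x := N), disj_consr _ (x := n), disj_blocksr _ (x := N)) //.
by do !bool_congr.
Qed.

(** The words d and e may share letters: they are the two ends of the contents of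
    a block of n on the left-hand side, whereas on the right-hand side they form
    e ++ n :: d, between two copies of N.  These two cores agree up to
    a rotation. *)
Lemma qs_shift_inside al gs d fs e hs be :
    avoids al -> avoids (flatten gs) -> avoids d -> avoids (flatten fs) ->
    avoids e -> avoids (flatten hs) -> avoids be ->
  quasi_stirling (al ++ blocks n gs ++ n :: d ++ blocks N fs ++ N :: e ++
                  blocks n hs ++ n :: be) =
  quasi_stirling (al ++ blocks N gs ++ N :: e ++ n :: d ++ blocks N fs ++
                  blocks N hs ++ N :: be).
Proof.
move=> /andP[Nal nal] /andP[Ng ng] /andP[Nd nd] /andP[Nfs nfs].
move=> /andP[Ne ne] /andP[Nhs nhs] /andP[Nbe nbe].
have Nn : N != n by rewrite eq_sym.
have disjE := (disj_catl, disj_catr, disj_consr _ (x := N), disj_consr _ (x := n),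
  disj_consl _ (x := N), disj_consl _ (x := n), disj_blocksr _ (x := N), disj_blocksl _ (x := N),
  disj_blocksr _ (x := n)).
have mE := (mem_cat, inE, negb_or).
have Nab : N \notin al ++ be by rewrite mem_cat negb_or Nal.
have nab : n \notin al ++ be by rewrite mem_cat negb_or nal.
rewrite qs_pinch_blocks //.
have -> : al ++ n :: d ++ blocks N fs ++ N :: e ++ blocks n hs ++ n :: be =
  (al ++ n :: d ++ blocks N fs ++ N :: e) ++ blocks n hs ++ n :: be.
  by rewrite -?catA /= -?catA /= -?catA /= -?catA.
rewrite qs_pinch_blocks //.
have -> : (al ++ n :: d ++ blocks N fs ++ N :: e) ++ n :: be =
  al ++ n :: (d ++ blocks N fs ++ N :: e) ++ n :: be.
  by rewrite -?catA /= -?catA /= -?catA /= -?catA.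
rewrite qs_piece; last first.
  by rewrite !mE mem_blocks !mE nN (negPf nN) andbF /= nd nfs ne.
rewrite qs_pinch_blocks //.
rewrite qs_pinch_blocks //.
have -> : al ++ N :: e ++ n :: d ++ blocks N fs ++ blocks N hs ++ N :: be =
  (al ++ N :: e ++ n :: d ++ blocks N fs) ++ blocks N hs ++ N :: be.
  by rewrite -?catA /= -?catA /= -?catA /= -?catA.
rewrite qs_pinch_blocks //.
have -> : (al ++ N :: e ++ n :: d ++ blocks N fs) ++ N :: be =
  (al ++ N :: e ++ n :: d) ++ blocks N fs ++ N :: be.
  by rewrite -?catA /= -?catA /= -?catA /= -?catA.
rewrite qs_pinch_blocks //.
have -> : (al ++ N :: e ++ n :: d) ++ N :: be =
  al ++ N :: (e ++ n :: d) ++ N :: be.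
  by rewrite -?catA /= -?catA /= -?catA /= -?catA.
rewrite qs_piece; last by rewrite !mE Ne Nn.
rewrite (@qs_fresh n e) // (qs_rot e) (@qs_fresh N d) //.
rewrite !(@qs_fresh _ al) // !(@qs_blocks_rename n N) //.
rewrite !disjE // -!andbA.
by do !bool_congr.
Qed.
Lemma qs_shift_adjacent al gs fs hs :
    avoids al -> avoids (flatten gs) -> avoids (flatten fs) -> fs != [::] ->
    avoids (flatten hs) ->
  quasi_stirling (al ++ blocks n gs ++ n :: blocks N fs ++ blocks n hs) =
  quasi_stirling (al ++ blocks N gs ++ n :: blocks N fs ++ blocks N hs).
Proof.
move=> /andP[Nal nal] /andP[Ng ng] /andP[Nfs nfs] fs0 /andP[Nhs nhs].
have Nn : N != n by rewrite eq_sym.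
have disjE := (disj_catl, disj_catr, disj_consr _ (x := N), disj_consr _ (x := n),
  disj_consl _ (x := N), disj_consl _ (x := n), disj_blocksr _ (x := N),
  disj_blocksl _ (x := N), disj_blocksr _ (x := n)).
have nB gs' : n \notin flatten gs' -> n \notin blocks N gs'.
  by move=> ngs'; rewrite mem_blocks (negPf nN) andbF.
case: fs fs0 Nfs nfs => // f fs _.
have -> : flatten (f :: fs) = f ++ flatten fs by [].
rewrite !mem_cat !negb_or => /andP[Nf Nfs] /andP[nf nfs].
have nFs : n \notin blocks N (f :: fs) by rewrite nB //= mem_cat negb_or nf.
rewrite qs_pinch_blocks //.
case: (lastP hs) Nhs nhs => [_ _|{}hs be].
  have -> : blocks n [::] = [::] by [].
  have -> : blocks N [::] = [::] by [].
  rewrite !cats0 (catA al) (@qs_fresh n (al ++ _)) //; last first.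
    by rewrite mem_cat negb_or nal nB.
  rewrite (@qs_fresh n al) // -catA blocks_cons qs_pinch_blocks //.
  rewrite (@qs_blocks_rename n N) // !disjE // -!andbA.
rewrite flatten_rcons !mem_cat !negb_or => /andP[Nhs Nbe] /andP[nhs nbe].
rewrite !blocks_rcons.
have -> : al ++ n :: blocks N (f :: fs) ++ blocks n hs ++ n :: be =
  (al ++ n :: blocks N (f :: fs)) ++ blocks n hs ++ n :: be.
  by rewrite -?catA /= -?catA.
rewrite qs_pinch_blocks //.
have -> : (al ++ n :: blocks N (f :: fs)) ++ n :: be =
  al ++ n :: blocks N (f :: fs) ++ n :: be.
  by rewrite -?catA /= -?catA.
rewrite qs_piece // (@qs_fresh n al) //.
have n1 : n \notin al ++ blocks N gs by rewrite mem_cat negb_or nal nB.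
have n2 : n \notin blocks N (f :: fs) ++ blocks N hs ++ N :: be.
  by rewrite mem_cat negb_or nFs mem_cat negb_or nB // inE negb_or nN nbe.
rewrite (catA al (blocks N gs)) (@qs_fresh n (al ++ _)) //.
rewrite -(catA al (blocks N gs)).
have -> : blocks N (f :: fs) ++ blocks N hs ++ N :: be =
  N :: (f ++ blocks N fs ++ blocks N hs ++ N :: be) by rewrite /= -!catA /= -?catA.
rewrite qs_pinch_blocks //.
have -> : al ++ N :: (f ++ blocks N fs ++ blocks N hs ++ N :: be) =
  (al ++ blocks N (f :: fs)) ++ blocks N hs ++ N :: be by rewrite /= -!catA /= -?catA.
rewrite qs_pinch_blocks // -(catA al (blocks N (f :: fs)) (N :: be)).
rewrite qs_pinch_blocks //=; last by rewrite mem_cat negb_or Nf.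
rewrite (@qs_fresh N al) // !(@qs_blocks_rename n N) //.
rewrite /= !disjE // -!andbA.
by do !bool_congr.
Qed.
End TwoLetters.

(** * Trading copies of the largest letter for copies of the second largest *)

(** The inverse of the assembly p ++ blocks x ps, where neither p nor ps contain
    x. *)
Fixpoint cut (x : nat) (w : seq nat) : seq nat * seq (seq nat) :=
  if w is c :: v then
    let: (p, ps) := cut x v in
    if c == x then ([::], p :: ps) else (c :: p, ps)
  else ([::], [::]).

Lemma cut_blocks x p ps : x \notin p -> x \notin flatten ps ->
  cut x (p ++ blocks x ps) = (p, ps).
Proof.
elim: p => [|c p IH]; last first.
  by rewrite /= inE negb_or eq_sym => /andP[/negPf cx xp] xps; rewrite IH // cx.
move=> _; rewrite cat0s; elim: ps => // g gs IH.
rewrite blocks_cons [flatten _]/= mem_cat negb_or => /andP[xg /IH{}IH].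
rewrite /= eqxx; elim: g xg => /= [|c g IHg]; first by rewrite IH.
rewrite inE negb_or eq_sym => /andP[/negPf cx xg]; move: (IHg xg).
by case: (cut x _) => p ps [-> ->]; rewrite cx.
Qed.

Lemma cutP x w : exists p ps, [/\ w = p ++ blocks x ps, x \notin p & x \notin flatten ps].
Proof.
elim: w => [|c w [p [ps [-> xp xps]]]]; first by exists [::], [::].
have [->|cx] := eqVneq c x.
  by exists [::], (p :: ps); rewrite /= mem_cat negb_or xp.
by exists (c :: p), ps; rewrite /= inE negb_or eq_sym cx.
Qed.

Lemma runs_cat_last x u v : last 0 u <= x -> x <= head x v ->
  runs (u ++ v) = runs u ++ runs v.
Proof.
case: v => [|y v]; first by rewrite !cats0.
by move=> ux xy; apply: runs_cat; apply: leq_trans ux xy.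
Qed.

Lemma runs_cat_max x u v : all (leq^~ x) u -> x <= head x v ->
  runs (u ++ v) = runs u ++ runs v.
Proof.
move=> ux; apply: runs_cat_last; case: u ux => // y u /allP H; exact/H/mem_last.
Qed.

Lemma head_blocks x y gs : x <= y -> x <= head x (blocks y gs).
Proof. by case: gs. Qed.

Lemma head_blocks_cat x y z gs v : x <= y -> x <= z ->
  x <= head x (blocks y gs ++ z :: v).
Proof. by case: gs. Qed.

Section Shift.
Variables (N n : nat) (Nn : N < n).

Definition small (s : seq nat) := all (ltn^~ N) s.

Lemma small_cat s t : small (s ++ t) = small s && small t.
Proof. exact: all_cat. Qed.

Lemma small_avoids s : small s -> avoids N n s.
Proof.
by move=> /allP sN; apply/andP; split; apply/negP=> /sN /=; lia.
Qed.

Lemma smallN s : small s -> N \notin s.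
Proof. by case/small_avoids/andP. Qed.
Lemma smalln s : small s -> n \notin s.
Proof. by case/small_avoids/andP. Qed.

Lemma all_blocks (p : pred nat) x gs : p x -> all p (flatten gs) -> all p (blocks x gs).
Proof. by move=> px; elim: gs => //= g gs IH; rewrite !all_cat px /= => /andP[->]. Qed.

Lemma small_le s y : small s -> N <= y -> all (leq^~ y) s.
Proof. by move=> + Ny; apply: sub_all => c /= cN; rewrite ltnW // (leq_trans cN). Qed.

Lemma blocks_le x y gs : x <= y -> N <= y -> small (flatten gs) ->
  all (leq^~ y) (blocks x gs).
Proof. by move=> xy Ny sg; apply: all_blocks => //; apply: small_le. Qed.

Lemma runs_blocks_rename gs : small (flatten gs) ->
  runs (blocks n gs) = runs (blocks N gs).
Proof.
elim: gs => // g gs IH; rewrite /small [flatten _]/= all_cat => /andP[sg sgs].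
have le_n : all (leq^~ n) (n :: g) by rewrite /= leqnn small_le // ltnW.
have le_N : all (leq^~ N) (N :: g) by rewrite /= leqnn small_le.
rewrite !blocks_cons -?cat_cons.
rewrite (runs_cat_max le_n) ?head_blocks // (runs_cat_max le_N) ?head_blocks // IH //.
congr (_ ++ _); apply: runs_max => //.
by apply: sub_all sg => c /= cN; exact: ltn_trans Nn.
Qed.

(** [shift k w w'] trades k - 1 of the k copies of n in w for copies of N.  The
    blocks to be moved or renamed are those in gs and hs.
    - before: some N precedes the first n.  The blocks of n, except the last one,
      move just in front of the last N that precedes n.
    - adjacent: no N precedes the first n, and some n is immediately followed
      by N.  All other n are renamed in place.
    - after: all N come after the last n, but not immediately.  The blocks of n
      move in front of the first N.
    - inside: all N lie in one block of n which is not the last one, but not at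
      its beginning.  The word d in front of the first N stays behind the
      surviving n, and the word e behind the last N is put in front of that n,
      because d and e may share letters.
    With c the number of N preceding the single n of w', the four cases have
    images with c >= k; c < k and n followed by N; c = 0 and n not followed by N;
    0 < c < k and n not followed by N. *)
Inductive shift (k : nat) : seq nat -> seq nat -> Prop :=
| Shift_before al fs e gs rest of small al & small (flatten fs) & small e &
    small (flatten gs) & all (leq^~ N) rest & size gs + 1 = k :
  shift k (al ++ blocks N (rcons fs e) ++ blocks n (rcons gs rest))
          (al ++ blocks N (fs ++ rcons gs e) ++ n :: rest)
| Shift_adjacent al gs fs hs of small al & small (flatten gs) &
    small (flatten fs) & fs != [::] & small (flatten hs) &
    size gs + 1 + size hs = k :
  shift k (al ++ blocks n gs ++ n :: blocks N fs ++ blocks n hs)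
          (al ++ blocks N gs ++ n :: blocks N fs ++ blocks N hs)
| Shift_after al gs be fs of small al & small (flatten gs) & small be &
    be != [::] & small (flatten fs) & fs != [::] & size gs + 1 = k :
  shift k (al ++ blocks n gs ++ n :: be ++ blocks N fs)
          (al ++ n :: be ++ blocks N (gs ++ fs))
| Shift_inside al gs d fs e hs be of small al & small (flatten gs) & small d &
    d != [::] & small (flatten fs) & small e & small (flatten hs) & small be &
    size gs + 1 + size hs + 1 = k :
  shift k (al ++ blocks n gs ++ n :: d ++ blocks N (rcons fs e) ++
             blocks n (rcons hs be))
          (al ++ blocks N (rcons gs e) ++ n :: d ++
             blocks N (fs ++ rcons hs be)).

Lemma shift_count k w w' p : shift k w w' ->
  count p w + k.-1 * p N = count p w' + k.-1 * p n.
Proof.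
have cE := (count_cat, count_blocks, size_rcons, size_cat,
  flatten_rcons, flatten_cat).
case=> *; subst k; rewrite ?cE /= ?cE /= ?cE ?addn1 ?addSn /=;
move: (nat_of_bool (p N)) (nat_of_bool (p n)) => a b; nia.
Qed.

Lemma shift_qs k w w' : shift k w w' -> quasi_stirling w = quasi_stirling w'.
Proof.
have nN : n != N by rewrite neq_ltn Nn orbT.
case=> [al fs e gs rest *|*|*|*].
- rewrite blocks_cat !blocks_rcons -!catA !(catA al).
  by apply: qs_shift_before => //; apply: small_avoids.
- by apply: qs_shift_adjacent => //; apply: small_avoids.
- by rewrite blocks_cat; apply: qs_shift_after => //; apply: small_avoids.
rewrite blocks_cat !blocks_rcons -!catA /=.
by apply: qs_shift_inside => //; apply: small_avoids.
Qed.

(** Both words are concatenations of the same blocks, up to order and to the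
    leading letters of blocks.  Cutting is legitimate in front of n always, and
    in front of N because the preceding letter is never n: be, d and fs are
    nonempty where they follow n. *)
Lemma shift_runs k w w' : shift k w w' -> perm_eq (runs w) (runs w').
Proof.
have Nn' := ltnW Nn; have leNN := leqnn N; have lenn := leqnn n.
have last_blocks x (fs : seq (seq nat)) : small (flatten fs) -> fs != [::] ->
    last x (blocks N fs) <= N.
  move=> sf; have /allP := blocks_le leNN leNN sf.
  by case: fs {sf} => // f fs H _; apply/H/mem_last.
have last_small x be : small be -> be != [::] -> last x be <= N.
  by case: be => // y be /allP H _; rewrite ltnW //; apply/H/mem_last.
have le_cons x e : N <= x -> small e -> all (leq^~ x) (x :: e).
  by move=> Nx se; rewrite /= leqnn small_le.
case=> al.
- move=> fs e gs rest sal sfs se sgs le_rest _.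
  rewrite blocks_cat !blocks_rcons -!catA !(catA al) -?cat_cons.
  have le_A : all (leq^~ N) (al ++ blocks N fs).
    by rewrite all_cat small_le //= blocks_le.
  rewrite !(runs_cat_max le_A) ?head_blocks_cat //.
  rewrite (runs_cat_max (le_cons N e leNN se)) ?head_blocks_cat //.
  rewrite (runs_cat_max (blocks_le lenn Nn' sgs)) //.
  rewrite (runs_cat_max (blocks_le leNN leNN sgs)) //.
  rewrite (runs_cat_max (le_cons N e leNN se)) // runs_blocks_rename //.
  by apply/permP=> p; rewrite !count_cat; lia.
- move=> gs fs hs sal sgs sfs fs0 shs _; rewrite -?cat_cons.
  rewrite !(runs_cat_max (small_le sal leNN)) ?head_blocks_cat //.
  rewrite (runs_cat_max (blocks_le lenn Nn' sgs)) //.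
  rewrite (runs_cat_max (blocks_le leNN leNN sgs)) //.
  have last_fs : last 0 (n :: blocks N fs) <= N by exact: (last_blocks n fs).
  rewrite !(runs_cat_last last_fs) ?head_blocks //.
  by rewrite !runs_blocks_rename.
- move=> gs be fs sal sgs sbe be0 sfs fs0 _; rewrite -?cat_cons.
  rewrite !(runs_cat_max (small_le sal leNN)) ?head_blocks_cat //.
  rewrite (runs_cat_max (blocks_le lenn Nn' sgs)) //.
  have last_be : last 0 (n :: be) <= N by exact: (last_small n be).
  rewrite !(runs_cat_last last_be) ?head_blocks // blocks_cat.
  rewrite (runs_cat_max (blocks_le leNN leNN sgs)) ?head_blocks //.
  rewrite runs_blocks_rename //.
  by apply/permP=> p; rewrite !count_cat; lia.
move=> gs d fs e hs be sal sgs sd d0 sfs se shs sbe _.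
have shb : small (flatten (rcons hs be)) by rewrite flatten_rcons small_cat shs.
rewrite !blocks_rcons -!catA -?cat_cons.
rewrite !(runs_cat_max (small_le sal leNN)) ?head_blocks_cat //.
rewrite (runs_cat_max (blocks_le lenn Nn' sgs)) //.
rewrite (runs_cat_max (blocks_le leNN leNN sgs)) //.
have last_d : last 0 (n :: d) <= N by exact: (last_small n d).
rewrite (runs_cat_max (le_cons N e leNN se)) //.
rewrite !(runs_cat_last last_d) ?head_blocks ?head_blocks_cat //.
rewrite blocks_cat !(runs_cat_max (blocks_le leNN leNN sfs)) ?head_blocks //.
rewrite -blocks_rcons !(runs_cat_max (le_cons N e leNN se)) ?head_blocks //.
rewrite !runs_blocks_rename //.
by apply/permP=> p; rewrite !count_cat; lia.
Qed.

(** The images under [shift] as functions: they exist to prove that [shift] is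
    functional in both directions. *)
Definition shift_fwd (w : seq nat) : seq nat :=
  let: (p, ps) := cut n w in
  if N \in p then
    let: (al, fs) := cut N p in
    al ++ blocks N (take (size fs).-1 fs ++ take (size ps).-1 ps ++
                     [:: last [::] fs]) ++ n :: last [::] ps
  else
    let j := find (fun g => N \in g) ps in
    let: gs := take j ps in
    let: hs := drop j.+1 ps in
    let: (d, fs) := cut N (nth [::] ps j) in
    if d == [::] then p ++ blocks N gs ++ n :: blocks N fs ++ blocks N hs
    else if hs == [::] then p ++ n :: d ++ blocks N (gs ++ fs)
    else p ++ blocks N (rcons gs (last [::] fs)) ++ n :: d ++
         blocks N (take (size fs).-1 fs ++ hs).

Definition shift_bwd (k : nat) (w : seq nat) : seq nat :=
  let: (l, r) := (take (index n w) w, drop (index n w).+1 w) in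
  let: (al, ps) := cut N l in
  if k <= size ps then
    let c := size ps - k in
    al ++ blocks N (rcons (take c ps) (last [::] ps)) ++
      blocks n (rcons (take k.-1 (drop c ps)) r)
  else
    let: (d, qs) := cut N r in
    if d == [::] then
      let c := size qs - (k.-1 - size ps) in
      al ++ blocks n ps ++ n :: blocks N (take c qs) ++ blocks n (drop c qs)
    else if ps == [::] then
      al ++ blocks n (take k.-1 qs) ++ n :: d ++ blocks N (drop k.-1 qs)
    else
      let c := size qs - (k - size ps) in
      al ++ blocks n (take (size ps).-1 ps) ++ n :: d ++
      blocks N (rcons (take c qs) (last [::] ps)) ++ blocks n (drop c qs).

Lemma find_first gs g hs : small (flatten gs) -> N \in g ->
  find (fun h => N \in h) (gs ++ g :: hs) = size gs.
Proof.
move=> sgs Ng; rewrite find_cat ifN /= ?Ng ?addn0 //.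
apply/hasPn=> h hgs; apply: contra (smallN sgs) => Nh; apply/flattenP; by exists h.
Qed.

Lemma shift_fwdE k w w' : shift k w w' -> shift_fwd w = w'.
Proof.
have nN : n != N by rewrite neq_ltn Nn orbT.
have nB gs : small (flatten gs) -> n \notin blocks N gs.
  by move/smalln; rewrite mem_blocks negb_or negb_and nN orbT.
rewrite /shift_fwd; case=> al.
- move=> fs e gs rest sal sfs se sgs le_rest _.
  have sfe : small (flatten (rcons fs e)) by rewrite flatten_rcons small_cat sfs.
  have nrest : n \notin rest by apply/negP=> /(allP le_rest) /=; lia.
  rewrite catA cut_blocks; last 2 first.
  + by rewrite mem_cat negb_or (smalln sal) nB.
  + by rewrite flatten_rcons mem_cat negb_or (smalln sgs).
  rewrite mem_cat mem_blocks size_rcons eqxx orbT /=.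
  rewrite cut_blocks ?smallN // !size_rcons /= !last_rcons -!cats1.
  by rewrite !take_size_cat.
- move=> gs fs hs sal sgs sfs fs0 shs _.
  have -> : al ++ blocks n gs ++ n :: blocks N fs ++ blocks n hs =
    al ++ blocks n (gs ++ blocks N fs :: hs) by rewrite blocks_cat.
  have nf : n \notin flatten (gs ++ blocks N fs :: hs).
    by rewrite flatten_cat /= !mem_cat !negb_or (smalln sgs) nB ?smalln.
  have NB : N \in blocks N fs by rewrite mem_blocks lt0n size_eq0 fs0 eqxx.
  rewrite cut_blocks ?(smalln sal) // (negPf (smallN sal)) find_first // take_size_cat //.
  rewrite nth_cat ltnn subnn -cat_rcons drop_size_cat ?size_rcons //=.
  by rewrite -[blocks N fs]cat0s cut_blocks ?smallN.
- move=> gs be fs sal sgs sbe be0 sfs fs0 _.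
  have -> : al ++ blocks n gs ++ n :: be ++ blocks N fs =
    al ++ blocks n (gs ++ [:: be ++ blocks N fs]) by rewrite blocks_cat /= cats0.
  have nf : n \notin flatten (gs ++ [:: be ++ blocks N fs]).
    by rewrite flatten_cat /= cats0 !mem_cat !negb_or (smalln sgs) nB ?smalln.
  have NB : N \in be ++ blocks N fs.
    by rewrite mem_cat mem_blocks lt0n size_eq0 fs0 eqxx orbT.
  rewrite cut_blocks ?(smalln sal) // (negPf (smallN sal)) find_first // take_size_cat //.
  rewrite nth_cat ltnn subnn drop_oversize ?size_cat ?addn1 //=.
  by rewrite cut_blocks ?smallN // (negPf be0).
move=> gs d fs e hs be sal sgs sd d0 sfs se shs sbe _.
set B := d ++ blocks N (rcons fs e).
have sfe : small (flatten (rcons fs e)) by rewrite flatten_rcons small_cat sfs.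
have shb : small (flatten (rcons hs be)) by rewrite flatten_rcons small_cat shs.
have -> : al ++ blocks n gs ++ n :: d ++ blocks N (rcons fs e) ++ blocks n (rcons hs be) =
    al ++ blocks n (gs ++ B :: rcons hs be) by rewrite blocks_cat /= /B -!catA.
have nf : n \notin flatten (gs ++ B :: rcons hs be).
  rewrite flatten_cat mem_cat negb_or (smalln sgs) [flatten _]/= mem_cat negb_or.
  by rewrite mem_cat negb_or (smalln sd) nB // smalln.
have NB : N \in B by rewrite mem_cat mem_blocks size_rcons eqxx orbT.
rewrite cut_blocks ?(smalln sal) // (negPf (smallN sal)) find_first // take_size_cat //.
rewrite nth_cat ltnn subnn -cat_rcons drop_size_cat ?size_rcons //=.
rewrite cut_blocks ?smallN // (negPf d0) -size_eq0 !size_rcons /=.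
by rewrite last_rcons -[rcons fs e]cats1 take_size_cat.
Qed.

Lemma shift_bwdE k w w' : shift k w w' -> shift_bwd k w' = w.
Proof.
have nN : n != N by rewrite neq_ltn Nn orbT.
have nB gs : small (flatten gs) -> n \notin blocks N gs.
  by move/smalln; rewrite mem_blocks negb_or negb_and nN orbT.
have cutn u v : n \notin u -> (take (index n (u ++ n :: v)) (u ++ n :: v) = u) *
    (drop (index n (u ++ n :: v)).+1 (u ++ n :: v) = v).
  move=> nu; rewrite index_cat (negPf nu) /= eqxx addn0 take_size_cat //.
  by rewrite -cat_rcons drop_size_cat ?size_rcons.
rewrite /shift_bwd; case=> al.
- move=> fs e gs rest sal sfs se sgs le_rest Ek.
  have sB : small (flatten (fs ++ rcons gs e)).
    by rewrite flatten_cat flatten_rcons !small_cat sfs sgs.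
  have nl : n \notin al ++ blocks N (fs ++ rcons gs e).
    by rewrite mem_cat negb_or (smalln sal) nB.
  rewrite catA !cutn // cut_blocks ?smallN // size_cat size_rcons -Ek addn1 leq_addl.
  rewrite addnK take_size_cat // drop_size_cat // last_cat last_rcons.
  by rewrite -[rcons gs e]cats1 take_size_cat.
- move=> gs fs hs sal sgs sfs fs0 shs Ek.
  have nl : n \notin al ++ blocks N gs by rewrite mem_cat negb_or (smalln sal) nB.
  rewrite catA !cutn // cut_blocks ?smallN // ifN; last by lia.
  rewrite -blocks_cat -[blocks N _]cat0s cut_blocks //; last first.
    by rewrite flatten_cat mem_cat negb_or !smallN.
  have -> : size (fs ++ hs) - (k.-1 - size gs) = size fs by rewrite size_cat; lia.
  by rewrite /= take_size_cat // drop_size_cat.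
- move=> gs be fs sal sgs sbe be0 sfs fs0 Ek.
  rewrite !cutn ?smalln // -[in cut N al](cats0 al) (@cut_blocks N al [::]) ?smallN //.
  rewrite ifN; last by rewrite /=; lia.
  rewrite cut_blocks ?smallN // ?flatten_cat ?small_cat ?sgs //.
  by rewrite (negPf be0) -Ek addn1 /= take_size_cat // drop_size_cat.
move=> gs d fs e hs be sal sgs sd d0 sfs se shs sbe Ek.
have sge : small (flatten (rcons gs e)) by rewrite flatten_rcons small_cat sgs.
have shb : small (flatten (rcons hs be)) by rewrite flatten_rcons small_cat shs.
have nl : n \notin al ++ blocks N (rcons gs e) by rewrite mem_cat negb_or (smalln sal) nB.
rewrite catA !cutn // cut_blocks ?smallN // ifN; last by rewrite size_rcons; lia.
rewrite cut_blocks ?smallN // ?flatten_cat ?small_cat ?sfs //.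
rewrite (negPf d0) -size_eq0 !size_rcons /=.
have -> : size (fs ++ rcons hs be) - (k - (size gs).+1) = size fs.
  by rewrite size_cat size_rcons; lia.
rewrite last_rcons take_size_cat // drop_size_cat // -[rcons gs e]cats1.
by rewrite take_size_cat.
Qed.

End Shift.

(** * The trade is a bijection *)

Definition qs_words (C : seq nat) : seq (seq nat) :=
  [seq w <- permutations C | quasi_stirling w].

Lemma sort_eqP (s t : seq nat) : reflect (sort leq s = sort leq t) (perm_eq s t).
Proof. apply: perm_sortP; [exact: leq_total | exact: leq_trans | exact: anti_leq]. Qed.

Definition run_type (w : seq nat) : seq nat := sort leq (runs w).

Lemma run_typeP w w' : reflect (run_type w = run_type w') (perm_eq (runs w) (runs w')).
Proof. exact: sort_eqP. Qed.

(** A relation that is total and functional in both directions between two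
    duplicate-free lists, and that preserves a statistic, makes the two lists of
    values agree up to order. *)
Lemma perm_map_rel (S T U : eqType) (P : S -> T -> Prop) (f : S -> U) (g : T -> U) s t :
    uniq s -> uniq t ->
    (forall x, x \in s -> exists2 y, y \in t & P x y) ->
    (forall y, y \in t -> exists2 x, x \in s & P x y) ->
    (forall x y y', P x y -> P x y' -> y = y') ->
    (forall x x' y, P x y -> P x' y -> x = x') ->
    (forall x y, P x y -> f x = g y) ->
  perm_eq (map f s) (map g t).
Proof.
move=> us ut Ps Pt func inj fg; elim: s t us ut Ps Pt => [|x s IH] t /=.
  case: t => // y t _ _ _ /(_ y); rewrite mem_head => /(_ isT)[] //.
case/andP=> xs us ut Ps Pt.
have [y yt Pxy] := Ps x (mem_head _ _).
rewrite (permPr (perm_map g (perm_to_rem yt))) /= (fg _ _ Pxy) perm_cons.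
apply: IH => // [|x' x's|y']; first exact: rem_uniq.
  have [|y' y't Py'] := Ps x'; first by rewrite inE x's orbT.
  exists y' => //; rewrite mem_rem_uniq // inE y't andbT.
  by apply: contraNneq xs => E; rewrite (inj x x' y') // E.
rewrite mem_rem_uniq // inE => /andP[y'y y't].
have [x' + Py'] := Pt y' y't; rewrite inE => /predU1P[E|]; last by exists x'.
by case/eqP: y'y; apply: (func x) => //; rewrite -E.
Qed.

Section Transfer.
Variables (N n a k : nat) (C : seq nat).
Hypotheses (Nn : N < n) (a_gt0 : 0 < a) (k_gt0 : 0 < k) (sC : small N C).

Definition source_mset := C ++ nseq a N ++ nseq k n.
Definition target_mset := C ++ nseq (a + k).-1 N ++ [:: n].

Lemma subseq_blocks x y gs : y \in flatten gs -> subseq [:: x; y] (blocks x gs).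
Proof.
elim: gs => // g gs IH; rewrite /= eqxx sub1seq mem_cat mem_cat => /orP[-> //|/IH].
by move/mem_subseq/(_ y); rewrite !inE eqxx orbT => ->; rewrite ?orbT.
Qed.

Lemma letters_small (w s : seq nat) : {subset w <= N :: n :: C} -> {subset s <= w} ->
  N \notin s -> n \notin s -> small N s.
Proof.
move=> wC sw Ns ns; apply/allP=> c cs; have := wC _ (sw _ cs).
rewrite !inE; case: eqP cs => [->|_]; first by rewrite (negPf Ns).
by case: eqP => [->|_ _ /= /(allP sC)//]; rewrite (negPf ns).
Qed.

Lemma source_sub w : perm_eq w source_mset -> {subset w <= N :: n :: C}.
Proof.
move/perm_mem=> wC c; rewrite wC !mem_cat !mem_nseq !inE.
by case/or3P=> [->|/andP[_ ->]|/andP[_ ->]]; rewrite ?orbT.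
Qed.

Lemma target_sub w : perm_eq w target_mset -> {subset w <= N :: n :: C}.
Proof.
move/perm_mem=> wC c; rewrite wC !mem_cat mem_nseq !inE.
by case/or3P=> [->|/andP[_ ->]|->]; rewrite ?orbT.
Qed.

Lemma rconsP (T : Type) (s : seq T) : 0 < size s -> exists t x, s = rcons t x.
Proof. by case: (lastP s) => // t x _; exists t, x. Qed.

(** Every word with these letters falls into one of the four cases, because the
    quasi-Stirling condition prevents N from occurring in two different gaps
    between the copies of n, or in such a gap and before the first n. *)
Lemma shift_total w : perm_eq w source_mset -> quasi_stirling w -> exists w', shift N n k w w'.
Proof.
move=> pw qw; have nN : n != N by rewrite neq_ltn Nn orbT.
have NC := smallN Nn sC; have nC := smalln Nn sC.
have [p [ps [Ew np nps]]] := cutP n w.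
have wC := source_sub pw.
have sub (s : seq nat) : (forall c, c \in s -> c \in w) -> N \notin s -> n \notin s -> small N s.
  exact: letters_small wC.
have Nw : N \in w by rewrite (perm_mem pw) !mem_cat mem_nseq a_gt0 eqxx orbT.
have sz_ps : size ps = k.
  have /permP/(_ (pred1 n)) := pw; rewrite Ew !count_cat count_blocks /= !count_nseq /= eqxx.
  by rewrite !(count_memPn _) //= eq_sym (negPf nN); lia.
have [Np|Np] := boolP (N \in p).
  have [|gs [rest Eps]] := @rconsP _ ps; first by rewrite sz_ps.
  have [al [fs0 [Ep Nal Nfs]]] := cutP N p.
  have [|fs [e Efs]] := @rconsP _ fs0.
    rewrite lt0n size_eq0; apply: contraTneq Np; rewrite Ep => ->; rewrite cats0.
    exact: Nal.
  subst ps fs0.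
  have Ngs : N \notin flatten gs.
    move: qw; rewrite Ew blocks_rcons qs_pinch_blocks; last first.
      by move: nps; rewrite flatten_rcons mem_cat; case/norP.
    by case/and3P=> _ _ /disjP D; apply: contraL Np => /D; rewrite mem_cat => /norP[].
  move: Nfs nps; rewrite !flatten_rcons !mem_cat => /norP[Nfs Ne] /norP[ngs nrest].
  have := np; rewrite Ep mem_cat mem_blocks flatten_rcons mem_cat => /norP[nal].
  case/norP=> _ /norP[nfs ne].
  have mw c : c \in al ++ flatten fs ++ e ++ flatten gs ++ rest -> c \in w.
    rewrite Ew Ep !mem_cat !mem_blocks !flatten_rcons !mem_cat.
    by do 4!case: (_ \in _); rewrite ?orbT //= => ->; rewrite ?orbT.
  have le_rest : all (leq^~ N) rest.
    apply/allP=> c cr; have: c \in w by apply: mw; rewrite !mem_cat cr !orbT.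
    move/wC; rewrite !inE => /or3P[/eqP->|/eqP cn|/(allP sC)/ltnW] //=.
    by rewrite -cn cr in nrest.
  eexists; rewrite Ew Ep -catA; apply: Shift_before => //; first [apply: sub => // c cs;
    apply: mw; rewrite !mem_cat cs ?orbT // | by rewrite -sz_ps size_rcons addn1].
pose j := find (fun g => N \in g) ps.
have has_N : has (fun g => N \in g) ps.
  move: Nw; rewrite Ew mem_cat (negPf Np) mem_blocks eq_sym (negPf nN) andbF.
  by case/flattenP=> g gps Ng; apply/hasP; exists g.
have NP := nth_find [::] has_N; move: has_N; rewrite has_find => lt_j.
have Ngs : N \notin flatten (take j ps).
  apply/negP=> /flattenP[g /(nthP [::])[i]].
  rewrite size_takel ?(ltnW lt_j) // => ij <-; apply/negP.
  by rewrite nth_take // (before_find [::] ij).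
have := cat_take_drop j ps; rewrite (drop_nth [::] lt_j).
move: Ngs NP; rewrite -/j; move: (take _ _) (nth _ _ _) (drop _ _) => gs P hs Ngs NP Eps.
subst ps => {j lt_j}.
(* Two blocks of n containing N would give the crossing n N n N. *)
have Nhs : N \notin flatten hs.
  apply/negP=> Nhs; case/negP: (qsPn qw nN).
  rewrite Ew blocks_cat /=; apply: subseq_trans (suffix_subseq _ _).
  apply: subseq_trans (suffix_subseq _ _).
  rewrite /= eqxx -[[:: N; n; N]]/([:: N] ++ [:: n; N]); apply: cat_subseq.
    by rewrite sub1seq.
  exact: subseq_blocks.
have [d [fs [EP Nd Nfs]]] := cutP N P.
have fs0 : fs != [::] by apply: contraTneq NP; rewrite EP => ->; rewrite cats0.
move: nps; rewrite flatten_cat /= EP !mem_cat mem_blocks.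
case/norP=> ngs /norP[/norP[nd /norP[_ nfs]] nhs].
have mw c : c \in p ++ flatten gs ++ d ++ flatten fs ++ flatten hs -> c \in w.
  rewrite Ew EP !mem_cat blocks_cat /= !mem_cat !mem_blocks inE mem_cat mem_cat mem_blocks mem_blocks.
  by do 4!case: (_ \in _); rewrite ?orbT //= => ->; rewrite ?orbT.
have [sp sgs sd sfs shs] : [/\ small N p, small N (flatten gs), small N d,
    small N (flatten fs) & small N (flatten hs)].
  by split; apply: sub => // c cs; apply: mw; rewrite !mem_cat cs ?orbT.
move: sz_ps; rewrite size_cat /= => Ek.
have [d0|d0] := eqVneq d [::].
  rewrite Ew EP d0 blocks_cat /=; eexists; apply: (@Shift_adjacent N n k p gs fs hs) => //.
  by rewrite -addnA add1n.
have [hs0|hs0] := eqVneq hs [::].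
  rewrite Ew EP hs0 blocks_cat /= cats0; eexists.
  by apply: (@Shift_after N n k p gs d fs) => //; rewrite hs0 in Ek.
move: (fs0) (hs0); rewrite -!size_eq0 -!lt0n => /rconsP[fs' [e Efs]] /rconsP[hs' [be Ehs]].
subst fs hs; move: sfs shs; rewrite !flatten_rcons !small_cat.
case/andP=> sfs se /andP[shs sbe]; rewrite size_rcons in Ek.
rewrite Ew EP blocks_cat /= -catA; eexists.
by apply: (@Shift_inside N n k p gs d fs' e hs' be) => //; rewrite -Ek !addn1 !addSn !addnS.
Qed.

(** The size of the list of blocks of N in front of n, compared with k, tells the
    case; the sizes required in [shift] then dictate where to split the lists. *)
Lemma shift_onto w' : perm_eq w' target_mset -> exists w, shift N n k w w'.
Proof.
move=> pw; have nN : n != N by rewrite neq_ltn Nn orbT.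
have NC := smallN Nn sC; have nC := smalln Nn sC.
have wC := target_sub pw.
have sub (s : seq nat) : (forall c, c \in s -> c \in w') -> N \notin s -> n \notin s -> small N s.
  exact: letters_small wC.
have cn : count_mem n w' = 1.
  rewrite (permP pw) !count_cat count_nseq /= eqxx (count_memPn _) //.
  by rewrite eq_sym (negPf nN).
have cN : count_mem N w' = (a + k).-1.
  rewrite (permP pw) !count_cat count_nseq /= eqxx (count_memPn _) //.
  by rewrite (negPf nN); lia.
have [l [rs [Ew nl nrs]]] := cutP n w'.
have : size rs = 1.
  by move: cn; rewrite Ew count_cat count_blocks /= eqxx !(count_memPn _) // muln1 addn0.
case: rs Ew nrs => [|r [|//]] //= + + _; rewrite !cats0 => Ew nr.
have [al [ps [El Nal Nps]]] := cutP N l.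
have := nl; rewrite El mem_cat mem_blocks => /norP[nal /norP[_ nps]].
have ml c : c \in al ++ flatten ps ++ r -> c \in w'.
  rewrite Ew El !mem_cat mem_blocks inE.
  by do 2!case: (_ \in _); rewrite ?orbT //= => ->; rewrite ?orbT.
have [sal sps] : small N al /\ small N (flatten ps).
  by split; apply: sub => // c cs; apply: ml; rewrite !mem_cat cs ?orbT.
have [kps|psk] := leqP k (size ps).
  have := cat_take_drop (size ps - k) ps; move: (take _ _) => fs.
  have [|gs [e Egs]] := @rconsP _ (drop (size ps - k) ps).
    by rewrite size_drop; clear -kps k_gt0; lia.
  have Esz : size (rcons gs e) = k by rewrite -Egs size_drop; clear -kps; lia.
  rewrite Egs => Eps; subst ps; rewrite size_rcons in Esz.
  move: sps; rewrite flatten_cat flatten_rcons !small_cat => /and3P[sfs sgs se].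
  eexists; rewrite Ew El -catA; apply: Shift_before => //; last by rewrite addn1.
  apply/allP=> c cr; have: c \in w' by apply: ml; rewrite !mem_cat cr !orbT.
  move/wC; rewrite !inE => /or3P[/eqP->|/eqP cn'|/(allP sC)/ltnW] //=.
  by rewrite -cn' cr in nr.
have [d [qs [Er Nd Nqs]]] := cutP N r.
have := nr; rewrite Er mem_cat mem_blocks => /norP[nd /norP[_ nqs]].
have [sd sqs] : small N d /\ small N (flatten qs).
  split; apply: sub => // c cs; apply: ml; rewrite Er !mem_cat ?mem_blocks cs ?orbT //.
have sz_qs : size ps + size qs = (a + k).-1.
  move: cN; rewrite Ew El Er !count_cat /= !count_cat !count_blocks /= eqxx.
  by rewrite (negPf nN) !(count_memPn _) // !muln1 !addn0 !add0n.
have [d0|d0] := eqVneq d [::].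
  pose c := size qs - (k.-1 - size ps).
  have sc : size (take c qs) = c by rewrite size_takel // /c leq_subr.
  have sc' : size (drop c qs) = size qs - c by rewrite size_drop.
  have Eqs := cat_take_drop c qs.
  move: sqs; rewrite -Eqs flatten_cat small_cat => /andP[sfs shs].
  rewrite Ew El Er d0 -Eqs blocks_cat /= -catA; eexists.
  apply: (@Shift_adjacent N n k al ps (take c qs) (drop c qs)) => //.
    have : 0 < size (take c qs) by rewrite sc /c; clear -sz_qs psk a_gt0; lia.
    by case: (take _ _).
  by rewrite sc' /c; clear -sz_qs psk a_gt0; lia.
have [ps0|ps0] := eqVneq ps [::].
  move: psk sz_qs; rewrite ps0 /= add0n => _ sz_qs.
  have Eqs := cat_take_drop k.-1 qs.
  move: sqs; rewrite -Eqs flatten_cat small_cat => /andP[sgs sfs].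
  rewrite Ew El Er ps0 cats0 -Eqs; eexists.
  apply: (@Shift_after N n k al (take k.-1 qs) d (drop k.-1 qs)) => //.
    have : 0 < size (drop k.-1 qs) by rewrite size_drop; clear -sz_qs k_gt0 a_gt0; lia.
    by case: (drop _ _).
  by rewrite size_takel; clear -sz_qs k_gt0 a_gt0; lia.
have [gs [e Eps]] : exists gs e, ps = rcons gs e.
  by apply: rconsP; rewrite lt0n size_eq0.
rewrite Eps size_rcons in psk sz_qs.
pose c := size qs - (k - (size gs).+1).
have sc' : size (drop c qs) = k - (size gs).+1 by rewrite size_drop /c; clear -sz_qs psk a_gt0; lia.
have [|hs [be Ehs]] := @rconsP _ (drop c qs); first by rewrite sc' subn_gt0.
have := cat_take_drop c qs; rewrite Ehs => Eqs.
move: sqs sps; rewrite Eps -Eqs flatten_cat !flatten_rcons !small_cat.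
case/and3P=> sfs shs sbe /andP[sgs se].
rewrite Ew El Er Eps -Eqs -catA; eexists.
apply: (@Shift_inside N n k al gs d (take c qs) e hs be) => //.
by move: sc'; rewrite Ehs size_rcons; clear -psk; lia.
Qed.

Lemma shift_perm w w' : shift N n k w w' -> perm_eq w source_mset = perm_eq w' target_mset.
Proof.
move=> R; have H p : count p w + k.-1 * p N + (count p target_mset + k.-1 * p n) =
    count p w' + k.-1 * p n + (count p source_mset + k.-1 * p N).
  rewrite (shift_count Nn p R) /source_mset /target_mset !count_cat !count_nseq /=.
  by rewrite addn0; move: (nat_of_bool _) (nat_of_bool _) => x y; nia.
by apply/permP/permP => E p; move: (H p) (E p); clear => /=; lia.
Qed.

Lemma shift_run_types :
  perm_eq (map run_type (qs_words source_mset)) (map run_type (qs_words target_mset)).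
Proof.
have memE C' w : (w \in qs_words C') = quasi_stirling w && perm_eq w C'.
  by rewrite mem_filter mem_permutations.
apply: (@perm_map_rel _ _ _ (shift N n k)).
- by rewrite filter_uniq ?permutations_uniq.
- by rewrite filter_uniq ?permutations_uniq.
- move=> w; rewrite memE => /andP[qw pw]; have [w' R] := shift_total pw qw.
  by exists w' => //; rewrite memE -(shift_qs Nn R) qw -(shift_perm R).
- move=> w'; rewrite memE => /andP[qw pw]; have [w R] := shift_onto pw.
  by exists w => //; rewrite memE (shift_qs Nn R) qw (shift_perm R).
- by move=> w w1 w2 /(shift_fwdE Nn)<- /(shift_fwdE Nn)<-.
- by move=> w1 w2 w /(shift_bwdE Nn)<- /(shift_bwdE Nn)<-.
by move=> w w' R; apply/run_typeP; apply: shift_runs R.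
Qed.
End Transfer.

(** * Inserting a new largest letter *)

Definition insert (n : nat) (w : seq nat) (i : nat) : seq nat :=
  take i w ++ n :: drop i w.

Lemma insert_inj n w w' i i' : n \notin w -> n \notin w' -> i <= size w ->
  i' <= size w' -> insert n w i = insert n w' i' -> w = w' /\ i = i'.
Proof.
move=> nw nw' iw iw' E; have nt v j : n \notin v -> n \notin take j v.
  by apply: contra => /mem_take.
have idx v j : n \notin v -> j <= size v -> index n (insert n v j) = j.
  move=> nv jv; rewrite /insert index_cat (negPf (nt _ _ nv)) /= eqxx addn0.
  by rewrite size_takel.
have Ei : i = i' by rewrite -(idx w i nw iw) E idx.
subst i'; split=> //; rewrite -(cat_take_drop i w) -(cat_take_drop i w').
by move/eqP: E; rewrite eqseq_cat ?size_takel // => /andP[/eqP-> /eqP[->]].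
Qed.

Lemma mem_qs_words C w : (w \in qs_words C) = quasi_stirling w && perm_eq w C.
Proof. by rewrite mem_filter mem_permutations. Qed.

Lemma uniq_qs_words C : uniq (qs_words C).
Proof. by rewrite filter_uniq ?permutations_uniq. Qed.

Lemma qs_words_insert n C : n \notin C ->
  perm_eq (qs_words (C ++ [:: n]))
          [seq insert n w i | w <- qs_words C, i <- iota 0 (size w).+1].
Proof.
move=> nC; have nw w : w \in qs_words C -> n \notin w.
  by rewrite mem_qs_words => /andP[_ /perm_mem->].
have perm_ins u v : perm_eq (u ++ n :: v) (C ++ [:: n]) = perm_eq (u ++ v) C.
  by rewrite (perm_catCA u [:: n] v) -cat1s perm_catC perm_cat2r.
apply: uniq_perm; first exact: uniq_qs_words.
  apply: allpairs_uniq_dep => [|w _|]; rewrite ?iota_uniq ?uniq_qs_words //.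
  move=> _ _ /allpairsPdep[w [i [wC iw ->]]] /allpairsPdep[w' [i' [w'C iw' ->]]] /=.
  move: iw iw'; rewrite !mem_iota !ltnS /= => iw iw'.
  by case/(insert_inj (nw _ wC) (nw _ w'C) iw iw') => <- <-.
move=> w; rewrite mem_qs_words; apply/andP/allpairsPdep => [[qw pw]|].
  have nw' : n \in w by rewrite (perm_mem pw) mem_cat mem_head orbT.
  case/splitPr: nw' qw pw => u v qw; rewrite perm_ins => pw.
  have nuv : n \notin u ++ v by rewrite (perm_mem pw).
  move: (nuv); rewrite mem_cat => /norP[nu nv].
  exists (u ++ v), (size u); split.
  - by rewrite mem_qs_words pw -(qs_fresh nu nv) qw.
  - by rewrite mem_iota /= add0n ltnS size_cat leq_addr.
  - by rewrite /insert take_size_cat // drop_size_cat.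
case=> v [i [vC _ ->]]; have nv := nw _ vC; move: nv vC.
rewrite mem_qs_words perm_ins -{1 2 3}(cat_take_drop i v) mem_cat => /norP[nt nd].
by rewrite qs_fresh // => /andP[].
Qed.

(** Inserting a largest letter in front of the run lengthens it; inserting it
    after i > 0 letters breaks the run there. *)
Definition split_run (r i : nat) : seq nat :=
  if i == 0 then [:: r.+1] else [:: i; (r - i).+1].

(** The last entry accounts for the insertion at the very end of the word, which
    creates a run of length 1. *)
Fixpoint insert_runs (rs : seq nat) : seq (seq nat) :=
  if rs is r :: rs' then
    [seq split_run r i ++ rs' | i <- iota 0 r] ++ [seq r :: t | t <- insert_runs rs']
  else [:: [:: 1]].

Lemma runs_insert n w : all (ltn^~ n) w ->
  [seq runs (insert n w i) | i <- iota 0 (size w).+1] = insert_runs (runs w).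
Proof.
elim/runs_ind: w => [_|r v r0 S L IH]; first by rewrite /= ltnn.
rewrite all_cat => /andP[rn vn].
have le_n s : all (ltn^~ n) s -> all (leq^~ n) s by apply: sub_all => c /ltnW.
rewrite size_cat -addnS iotaD map_cat add0n runs_cat // runs_decreasing // cat1s.
rewrite [insert_runs _]/=; congr (_ ++ _).
  apply/eq_in_map => i; rewrite mem_iota /= add0n => ir.
  rewrite /insert take_cat drop_cat ir.
  rewrite (@runs_cat_max n) //; last first.
    by rewrite le_n //; apply/allP=> c /mem_take; apply: (allP rn).
  have Sd := drop_sorted i S; have dn : all (ltn^~ n) (drop i r).
    by apply/allP=> c /mem_drop; apply: (allP rn).
  have El : last 0 (drop i r) = last 0 r.
    by rewrite -{2}(cat_take_drop i r) last_cat; case: (drop i r) (size_drop i r) => //=; lia.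
  have -> : runs (n :: drop i r ++ v) = (size r - i).+1 :: runs v.
    rewrite -cat_cons runs_cat; last first.
      move: El; case: (drop i r) (size_drop i r) => [|x s] /=; first by lia.
      by move=> _ ->; case: (v) L.
    rewrite runs_decreasing //= ?size_drop //.
    by case: (drop i r) Sd dn => //= x s -> /andP[->].
  rewrite /split_run; case: i ir {Sd dn El} => [|i] ir; first by rewrite take0 subn0.
  rewrite runs_decreasing ?take_sorted // ?size_takel //; first exact: ltnW.
  by rewrite -size_eq0 size_takel // ltnW.
rewrite -IH // -[X in iota X _]addn0 iotaDl -!map_comp.
apply: eq_map => i /=; rewrite /insert take_cat drop_cat ltnNge leq_addr /= addKn.
rewrite -catA runs_cat ?(runs_decreasing r0 S) //.
case: i v L vn IH => [|i] [|y v] //= L vn _; rewrite ?take0 //=.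
all: apply: ltnW; apply: (allP rn); case: (r) r0 => // x s _; exact: mem_last.
Qed.

Lemma eq_perm (T : eqType) (s t : seq T) : s = t -> perm_eq s t.
Proof. by move->. Qed.

(** A description of [insert_runs] that does not refer to the order of the runs,
    hence is invariant under permutations. *)
Definition insert_types (rs : seq nat) : seq (seq nat) :=
  sort leq (1 :: rs) ::
  flatten [seq [seq sort leq (split_run r i ++ rem r rs) | i <- iota 0 r] | r <- rs].

Lemma insert_runs_types rs :
  perm_eq (map (sort leq) (insert_runs rs)) (insert_types rs).
Proof.
elim: rs => // r rs IH; rewrite /insert_types /= map_cat eqxx.
have -> : map (sort leq) (map (cons r) (insert_runs rs)) =
    map (sort leq \o cons r) (map (sort leq) (insert_runs rs)).
  by rewrite -!map_comp; apply: eq_map => t /=; apply/sort_eqP;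
     rewrite perm_cons perm_sym perm_sort.
rewrite (permPl (perm_cat (perm_refl _) (perm_map _ IH))) /insert_types /=.
rewrite perm_catC /= -map_comp.
have -> : sort leq (r :: sort leq (1 :: rs)) = sort leq [:: 1, r & rs].
  by apply/sort_eqP; rewrite perm_sym (perm_catCA [:: 1] [:: r] rs) perm_cons perm_sym perm_sort.
rewrite perm_cons perm_catC; apply: perm_cat => //.
rewrite map_flatten -map_comp; apply: eq_perm; congr flatten.
apply/eq_in_map => r' r'rs /=; rewrite -map_comp; apply: eq_map => i /=.
apply/sort_eqP; rewrite (@perm_trans _ (r :: split_run r' i ++ rem r' rs)) //.
  by rewrite perm_cons perm_sort.
rewrite (perm_catCA [:: r]) perm_cat2l /=; case: eqP => [->|_] //.
by rewrite perm_sym perm_to_rem.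
Qed.

Lemma insert_types_perm rs rs' : perm_eq rs rs' ->
  perm_eq (insert_types rs) (insert_types rs').
Proof.
move=> prs; rewrite /insert_types.
have -> : sort leq (1 :: rs) = sort leq (1 :: rs') by apply/sort_eqP; rewrite perm_cons.
rewrite perm_cons; apply: perm_flatten.
apply: (perm_trans (perm_map _ prs)); apply: eq_perm.
apply: eq_map => r; apply: eq_map => i; apply/sort_eqP.
rewrite perm_cat2l; apply/permP => p.
by rewrite !count_rem (permP prs) (perm_mem prs).
Qed.

Lemma perm_flatten_map (S T : eqType) (f g : S -> seq T) s :
  {in s, forall x, perm_eq (f x) (g x)} ->
  perm_eq (flatten (map f s)) (flatten (map g s)).
Proof.
elim: s => //= x s IH H; apply: perm_cat; first by apply: H; rewrite mem_head.
by apply: IH => y ys; apply: H; rewrite inE ys orbT.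
Qed.

Lemma run_types_insert n C : all (ltn^~ n) C ->
  perm_eq (map run_type (qs_words (C ++ [:: n])))
          (flatten (map insert_types (map run_type (qs_words C)))).
Proof.
move=> Cn; have nC : n \notin C by apply/negP=> /(allP Cn) /=; rewrite ltnn.
apply: (perm_trans (perm_map _ (qs_words_insert nC))).
rewrite map_allpairs -map_comp; apply: perm_flatten_map => w.
rewrite mem_qs_words => /andP[_ pw].
have wn : all (ltn^~ n) w by rewrite (perm_all _ pw).
rewrite (map_comp (sort leq) (fun i => runs (insert n w i))) runs_insert //.
apply: (perm_trans (insert_runs_types _)); apply: insert_types_perm.
by rewrite /run_type perm_sym perm_sort.
Qed.

Lemma run_types_insert_perm n C C' : all (ltn^~ n) C -> all (ltn^~ n) C' ->
  perm_eq (map run_type (qs_words C)) (map run_type (qs_words C')) ->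
  perm_eq (map run_type (qs_words (C ++ [:: n])))
          (map run_type (qs_words (C' ++ [:: n]))).
Proof.
move=> Cn C'n p; apply: (perm_trans (run_types_insert Cn)).
rewrite perm_sym; apply: (perm_trans (run_types_insert C'n)).
by rewrite perm_sym; apply/perm_flatten/perm_map.
Qed.

(** * Induction on the number of letters *)

(** The word [mset_word], with the multiplicities given as a sequence, so that
    the induction can add and drop letters at the end. *)
Definition mword (ks : seq nat) : seq nat :=
  flatten [seq nseq (nth 0 ks i) i.+1 | i <- iota 0 (size ks)].

Lemma mword_rcons ks k : mword (rcons ks k) = mword ks ++ nseq k (size ks).+1.
Proof.
rewrite /mword size_rcons -addn1 iotaD map_cat flatten_cat /= cats0 add0n.
rewrite nth_rcons ltnn eqxx; congr (_ ++ _); last by rewrite addn1.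
congr flatten; apply/eq_in_map => i.
by rewrite mem_iota add0n nth_rcons => /andP[_ ->].
Qed.

Lemma mword_lt ks : all (ltn^~ (size ks).+1) (mword ks).
Proof.
elim/last_ind: ks => // ks k IH; rewrite mword_rcons all_cat size_rcons.
rewrite all_nseq /= ltnS leqnn orbT andbT.
by apply: sub_all IH => c /= /ltnW.
Qed.

(** The trade brings the multiplicity of the largest letter down to 1 while
    keeping the number of letters and the total multiplicity. *)
Lemma run_types_reduce m ks : size ks = m.+2 -> all (ltn 0) ks ->
  exists ks', [/\ size ks' = m.+1, all (ltn 0) ks', sumn ks' + 1 = sumn ks &
    perm_eq (map run_type (qs_words (mword ks)))
            (map run_type (qs_words (mword ks' ++ [:: m.+2])))].
Proof.
elim/last_ind: ks => // ks k _; rewrite size_rcons => -[].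
elim/last_ind: ks => // ks a _; rewrite size_rcons => -[sz].
rewrite !all_rcons => /and3P[k0 a0 ks0].
exists (rcons ks (a + k).-1); split.
- by rewrite size_rcons sz.
- by rewrite all_rcons ks0 andbT /=; move: k0 a0 => /=; lia.
- by rewrite !sumn_rcons; move: k0 a0 => /=; lia.
rewrite !mword_rcons size_rcons sz -!catA.
apply: shift_run_types => //; rewrite /small -sz; exact: mword_lt.
Qed.

Lemma run_types_mword ks ks' : size ks = size ks' ->
  all (ltn 0) ks -> all (ltn 0) ks' -> sumn ks = sumn ks' ->
  perm_eq (map run_type (qs_words (mword ks))) (map run_type (qs_words (mword ks'))).
Proof.
move: {2}(size ks) (erefl (size ks)) => m.
elim: m ks ks' => [|[|m] IH] ks ks' sz sz' p p' E.
- by move: sz sz'; case: ks {p E} => // _; case: ks' {p'}.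
- move: sz sz' E; case: ks {p} => [|x [|]] //= _; case: ks' {p'} => [|y [|]] //= _.
  by rewrite !addn0 => ->.
have [k1 [sz1 p1 E1 H1]] := run_types_reduce sz p.
rewrite sz in sz'; have [k2 [sz2 p2 E2 H2]] := run_types_reduce (esym sz') p'.
apply: (perm_trans H1); rewrite perm_sym; apply: (perm_trans H2); rewrite perm_sym.
apply: run_types_insert_perm; rewrite -?sz1 ?mword_lt //; first by rewrite sz1 -sz2 mword_lt.
by apply: IH => //; [rewrite sz1 sz2 | lia].
Qed.

(** * From equidistribution to a bijection *)
Lemma perm_map_bij (T : eqType) (U : eqType) (x0 : T) (f : T -> U) (s t : seq T) :
  uniq s -> uniq t -> perm_eq (map f s) (map f t) ->
  exists g h : T -> T,
    {in s, forall x, [/\ g x \in t, h (g x) = x & f (g x) = f x]} /\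
    {in t, forall y, h y \in s /\ g (h y) = y}.
Proof.
move=> us ut /(perm_iotaP (f x0)) [Is pI E]; rewrite size_map in pI.
pose t' := map (nth x0 t) Is.
have pt : perm_eq t' t.
  by rewrite (permPl (perm_map _ pI)) map_nth_iota0 ?take_size.
have Ef : map f s = map f t'.
  rewrite E -map_comp; apply/eq_in_map => i; rewrite (perm_mem pI) mem_iota => /andP[_ it] /=.
  by rewrite (nth_map x0).
have sz : size s = size t' by rewrite -(size_map f s) Ef size_map.
have ut' : uniq t' by rewrite (perm_uniq pt).
exists (fun x => nth x0 t' (index x s)), (fun y => nth x0 s (index y t')).
split=> [x xs|y]; last first.
  rewrite -(perm_mem pt) => yt; rewrite mem_nth ?sz ?index_mem //.
  by rewrite index_uniq ?sz ?index_mem // nth_index.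
have xt : index x s < size t' by rewrite -sz index_mem.
rewrite -(perm_mem pt) mem_nth // index_uniq // nth_index //; split=> //.
by rewrite -(nth_map x0 (f x0)) // -Ef (nth_map x0) ?index_mem // nth_index.
Qed.

Lemma mset_word_mword n (k : 'I_n -> nat) : mset_word k = mword (map k (enum 'I_n)).
Proof.
rewrite /mset_word /mword size_map size_enum_ord -val_enum_ord -map_comp.
congr flatten; apply: eq_map => i /=.
by rewrite (nth_map i) ?size_enum_ord // nth_ord_enum.
Qed.

Lemma sum_mult1 n (k : 'I_n -> nat) : 0 < n -> (forall i, 0 < k i) ->
  \sum_(l < n) mult1 k l = \sum_(l < n) k l.
Proof.
case: n k => // n k _ k0.
have sum1 m : \sum_(i < m) 1 = m by rewrite sum1_card card_ord.
have : \sum_(l < n.+1) 1 <= \sum_(l < n.+1) k l by apply: leq_sum.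
have -> : \sum_(l < n.+1) mult1 k l = \sum_(l < n.+1) k l - n.+1 + 1 + n.
  by rewrite big_ord_recl; congr (_ + _); rewrite -[RHS]sum1; apply: eq_bigr.
rewrite sum1; lia.
Qed.

Theorem theorem1p1 (n : nat) (k : 'I_n -> nat)
    (hn : 1 <= n) (hk : forall i : 'I_n, 0 < k i) :
  exists Psi : QS k -> QS (mult1 k),
    bijective Psi /\
    forall pi : QS k,
      DR n (sval pi) = DR n (sval (Psi pi)) /\
      dec_patterns n (sval pi) = dec_patterns n (sval (Psi pi)).
Proof.
have memE m (l : 'I_m -> nat) w : (w \in qs_words (mset_word l)) =
    perm_eq w (mset_word l) && quasi_stirling w by rewrite mem_qs_words andbC.
have sumE (l : 'I_n -> nat) : sumn (map l (enum 'I_n)) = \sum_(i < n) l i.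
  by rewrite sumnE big_map big_enum.
have : perm_eq (map run_type (qs_words (mset_word k)))
               (map run_type (qs_words (mset_word (mult1 k)))).
  rewrite !mset_word_mword; apply: run_types_mword; rewrite ?size_map //.
  - by rewrite all_map; apply/allP=> i _; apply: hk.
  - by rewrite all_map; apply/allP=> i _; rewrite /= /mult1; case: ifP; rewrite ?addn1.
  by rewrite !sumE sum_mult1.
case/(perm_map_bij [::] (uniq_qs_words _) (uniq_qs_words _)) => g [h [gP hP]].
have gQ (pi : QS k) : perm_eq (g (sval pi)) (mset_word (mult1 k)) && quasi_stirling (g (sval pi)).
  by rewrite -memE; have [|-> _ _] := gP (sval pi); rewrite ?memE ?(svalP pi).
have hQ (pi : QS (mult1 k)) : perm_eq (h (sval pi)) (mset_word k) && quasi_stirling (h (sval pi)).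
  by rewrite -memE; have [|-> _] := hP (sval pi); rewrite ?memE ?(svalP pi).
exists (fun pi => exist _ (g (sval pi)) (gQ pi)); split.
  exists (fun pi => exist _ (h (sval pi)) (hQ pi)) => pi; apply: val_inj => /=.
    by have [|_ -> _] := gP (sval pi); rewrite ?memE ?(svalP pi).
  by have [|_ ->] := hP (sval pi); rewrite ?memE ?(svalP pi).
move=> pi; apply: DR_runs; apply/run_typeP => /=.
by have [|_ _ ->] := gP (sval pi); rewrite ?memE ?(svalP pi).
Qed.
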